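(* In the setting of the context (a stochastic evolution equation $u_t=Au+F(u)+\sigma\dot W$ on a separable Hilbert space $H$ satisfying the exponential dichotomy and spectral gap condition, with unique stationary solution $u^*$, and with $z^*$ the stationary solution of the linear equation $z_t=Az+\sigma\dot W$), let $M(\omega)$ be the random invariant manifold of the equation constructed by the Lyapunov--Perron method around $u^*$ via $U=u-u^*$, and let $\widetilde M(\omega)$ be the random invariant manifold of the random equation $V_t=AV+F(V+z^*(\theta_t\omega))$ constructed by the Lyapunov--Perron method, where $V=u-z^*$. Then, for almost all $\omega$, $$M(\omega)=\widetilde M(\omega)+z^*(\omega).$$
   Context: $H$ is a separable Hilbert space with norm $\|\cdot\|_H$. $W$ is a two-sided $H$-valued Wiener process with trace-class covariance on the canonical Wiener space $(\Omega,\mathcal F,\mathbb P)$, $\Omega=\{w\in C(\mathbb R,H):w(0)=0\}$, with Wiener shift $\theta_t\omega(\cdot)=\omega(\cdot+t)-\omega(t)$; $\sigma$ is a constant. $F:H\to H$ is globally Lipschitz with constant $L_F$. $A:D(A)\subset H\to H$ generates a strongly continuous semigroup which extends to a group $\{e^{At}\}_{t\in\mathbb R}$. **Exponential dichotomy.** There are $\beta<\alpha<0$, $K>0$ and a continuous projection $P$ on $H$ such that $Pe^{At}=e^{At}P$ for $t\in\mathbb R$; $e^{At}|_{R(P)}$ is an isomorphism of $R(P)$ onto itself for $t\ge0$; $\|e^{At}Px\|_H\le Ke^{\alpha t}\|x\|_H$ for $t\le0$; $\|e^{At}(I-P)x\|_H\le Ke^{\beta t}\|x\|_H$ for $t\ge0$.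 Write $Q=I-P$. **Gap condition.** $\eta<0$, $\beta<\eta<\alpha$, is chosen with $KL_F\big(\frac1{\alpha-\eta}+\frac1{\eta-\beta}\big)<1$. **Stationary solutions.** The equation $u_t=Au+F(u)+\sigma\dot W$ has a unique stationary solution $u^*(t,\omega)=u^*(\theta_t\omega)$. The stationary process $z^*(t,\omega)=z^*(\theta_t\omega)$ with $z^*(\omega)=\sigma\int_{-\infty}^0e^{-As}dW(s,\omega)$ is well defined and solves $z_t=Az+\sigma\dot W$. We write $u^*(s)=u^*(\theta_s\omega)$, $z^*(s)=z^*(\theta_s\omega)$. **Function space.** $C^-_{\eta,H}=\{u\in C((-\infty,0];H):\sup_{t\le0}e^{-\eta t}\|u(t)\|_H<\infty\}$. **The manifold $M$.** $U=u-u^*$ satisfies $U_t=AU+F(U+u^*(\theta_t\omega))-F(u^*(\theta_t\omega))$. For $\xi\in PH$ let $\bar U(\cdot,\xi)$ be the unique solution in $C^-_{\eta,H}$ of $$\bar U(t,\xi)=e^{At}(\xi-Pu^*(0))+\int_0^te^{A(t-s)}P[F(\bar U(s)+u^*(s))-F(u^*(s))]ds+\int_{-\infty}^te^{A(t-s)}Q[F(\bar U(s)+u^*(s))-F(u^*(s))]ds,\quad t\le 0,$$ and $M(\omega)=\{\bar U(0,\xi)+u^*(\omega):\xi\in PH\}$. **The manifold $\widetilde M$.** For $\xi\in PH$ let $\tilde V(\cdot,\xi)$ be the unique solution in $C^-_{\eta,H}$ of $$\tilde V(t,\xi)=e^{At}(\xi-Pz^*(0))+\int_0^te^{A(t-s)}PF(\tilde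 V(s)+z^*(s))ds+\int_{-\infty}^te^{A(t-s)}QF(\tilde V(s)+z^*(s))ds,\quad t\le 0,$$ let $\tilde h(\xi,\omega)=Q\tilde V(0,\xi)$, and $\widetilde M(\omega)=\{\xi-Pz^*(0)+\tilde h(\xi,\omega):\xi\in PH\}$. *)

(* Defs.v *)
From HB Require Import structures.
From mathcomp Require Import all_boot all_order all_algebra.
From mathcomp Require Import all_classical all_reals all_analysis.

Set Implicit Arguments.
Unset Strict Implicit.
Unset Printing Implicit Defensive.

Import Order.TTheory GRing.Theory Num.Theory.
Import numFieldNormedType.Exports.

Local Open Scope classical_set_scope.
Local Open Scope ring_scope.

(* A real Hilbert space is a complete normed module together with a positive
   definite symmetric bilinear form inducing its norm. *)
Definition hilbert (R : realType) (H : completeNormedModType R)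
    (ip : {dot H for @idfun R}) : Prop :=
  forall x : H, ip x x = `|x| ^+ 2.

Definition separable (T : topologicalType) : Prop :=
  exists2 D : set T, countable D & dense D.

Notation borel H := (g_sigma_algebraType (@open H)).

Record path0 (R : realType) (H : normedModType R) := Path0 {
  path_fun :> R -> H;
  path_continuous : continuous path_fun;
  path_0 : path_fun 0 = 0 }.

Section PathSpace.
Context {R : realType} {H : normedModType R}.
Implicit Types (w : path0 H) (s t : R).

HB.instance Definition _ := gen_eqMixin (path0 H).
HB.instance Definition _ := gen_choiceMixin (path0 H).

Fact zero_path_continuous : continuous (fun _ : R => 0 : H).
Proof. exact: cst_continuous. Qed.

HB.instance Definition _ := isPointed.Build (path0 H)
  (Path0 zero_path_continuous erefl).

Fact wshift_continuous t w : continuous (fun s => w (s + t) - w t).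
Proof.
move=> s; apply: cvgB; last exact: cvg_cst.
apply: (@continuous_comp _ _ _ (fun s => s + t) w).
  by apply: cvgD; [exact: cvg_id|exact: cvg_cst].
exact: path_continuous.
Qed.

Fact wshift_0 t w : w (0 + t) - w t = 0.
Proof. by rewrite add0r subrr. Qed.

Definition wshift t w : path0 H :=
  Path0 (@wshift_continuous t w) (@wshift_0 t w).

(* For separable H these sets generate the Borel sigma-algebra of locally
   uniform convergence. *)
Definition cylinders : set (set (path0 H)) :=
  [set C | exists t (B : set H), open B /\ C = [set w : path0 H | B (w t)]].

End PathSpace.

Notation wienerSpace H := (g_sigma_algebraType (@cylinders _ H)).

Section WienerMeasure.
Context {R : realType} {H : completeNormedModType R}.
Variable ip : {dot H for @idfun R}.

Definition orthonormal_basis (I : countType) (e : I -> H) : Prop :=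
  (forall i j, ip (e i) (e j) = (i == j)%:R) /\
  (forall x, (forall i, ip x (e i) = 0) -> x = 0).

(* A nonnegative operator is trace class iff its trace in an orthonormal basis
   (which does not depend on the basis) is finite. *)
Definition trace_class_covariance (C : {linear H -> H}) : Prop :=
  [/\ continuous C,
      forall x y, ip (C x) y = ip x (C y),
      forall x, 0 <= ip (C x) x &
      exists (I : countType) (e : I -> H), orthonormal_basis e /\
        (\esum_(i in [set: I]) (ip (C (e i)) (e i))%:E < +oo)%E].

(* The centered Gaussian law of variance v; [normal_prob] takes the standard
   deviation and is not a Dirac mass when that is 0. *)
Definition centered_normal (v : R) (B : set R) : \bar R :=
  if v == 0 then \d_(0 : R) B else normal_prob 0 (Num.sqrt v) B.

(* The law N(0, tau C) on H is the one whose image under each <., h> is centered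
   normal with variance tau <C h, h>. *)
Definition gaussian_law (N : probability (borel H) R) (tau : R)
    (C : {linear H -> H}) : Prop :=
  forall (h : H) (B : set R), measurable B ->
    N [set x | B (ip x h)] = centered_normal (tau * ip (C h) h) B.

Definition increment (s t : R) (B : set H) : set (wienerSpace H) :=
  [set w : path0 H | B (w t - w s)].

Definition independent_increments (Pr : probability (wienerSpace H) R) : Prop :=
  forall (n : nat) (t : nat -> R) (B : nat -> set (borel H)),
    (forall i, t i <= t i.+1) -> (forall i, measurable (B i)) ->
    Pr (\bigcap_(i < n) increment (t i) (t i.+1) (B i)) =
    (\prod_(i < n) Pr (increment (t i) (t i.+1) (B i)))%E.

(* The coordinate process W(t, w) = w t is a two-sided Wiener process: path0
   gives W(0) = 0 and continuity; increments over the whole line are independent,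
   and W(t) - W(s) has law N(0, (t - s) C). *)
Definition wiener_measure (C : {linear H -> H})
    (Pr : probability (wienerSpace H) R) : Prop :=
  (exists N : R -> probability (borel H) R,
     (forall tau, 0 < tau -> gaussian_law (N tau) tau C) /\
     (forall s t (B : set (borel H)), s < t -> measurable B ->
        Pr (increment s t B) = N (t - s) B)) /\
  independent_increments Pr.

End WienerMeasure.

Section Integrals.
Context {R : realType} {H : completeNormedModType R}.

(* v is the integral of f over D: f is weakly measurable with integrable norm
   and v is characterized through continuous linear functionals.  For separable
   H this is the Bochner integral, by Pettis' theorem. *)
Definition is_integral (D : set R) (f : R -> H) (v : H) : Prop :=
  lebesgue_measure.-integrable D (fun s => `|f s|%:E) /\
  forall phi : {linear H -> R^o}, continuous phi ->
    lebesgue_measure.-integrable D (fun s => (phi (f s))%:E) /\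
    (phi v)%:E = (\int[lebesgue_measure]_(s in D) (phi (f s))%:E)%E.

(* v is the integral of f from a to b, with the usual sign when b < a. *)
Definition is_oriented_integral (a b : R) (f : R -> H) (v : H) : Prop :=
  if a <= b then is_integral `[a, b] f v else is_integral `[b, a] f (- v).

End Integrals.

Section WienerIntegral.
Context {R : realType} {H : completeNormedModType R}.
Variable Pr : probability (wienerSpace H) R.

Definition borel_measurable (X : path0 H -> H) : Prop :=
  measurable_fun setT (X : wienerSpace H -> borel H).

Definition square_integrable (X : path0 H -> H) : Prop :=
  borel_measurable X /\ (\int[Pr]_w (`|X w| ^+ 2)%:E < +oo)%E.

Definition mean_square_dist (X Y : path0 H -> H) : \bar R :=
  (\int[Pr]_w (`|X w - Y w| ^+ 2)%:E)%E.

Definition wiener_sum (Phi : R -> H -> H) (n : nat) (t : nat -> R)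
    (w : path0 H) : H :=
  \sum_(i < n) Phi (t i) (w (t i.+1) - w (t i)).

Definition partition_mesh (a b delta : R) (n : nat) (t : nat -> R) : Prop :=
  [/\ t 0%N = a, t n = b &
      forall i, (i < n)%N -> t i <= t i.+1 /\ t i.+1 - t i < delta].

(* X is the integral of the deterministic, strongly continuous operator-valued
   integrand Phi against dW over [a, b], as a mean-square limit of sums over
   partitions whose mesh tends to 0. *)
Definition is_wiener_integral (Phi : R -> H -> H) (a b : R)
    (X : path0 H -> H) : Prop :=
  square_integrable X /\
  forall e : R, 0 < e -> exists2 delta : R, 0 < delta &
    forall n t, partition_mesh a b delta n t ->
      (mean_square_dist X (wiener_sum Phi n t) < e%:E)%E.

(* Integral over (-oo, b], as the mean-square limit of the integrals over
   [a, b] when a tends to -oo. *)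
Definition is_wiener_integral_ninfty (Phi : R -> H -> H) (b : R)
    (X : path0 H -> H) : Prop :=
  square_integrable X /\
  forall e : R, 0 < e -> exists2 a0 : R, a0 <= b &
    forall a, a <= a0 -> exists2 Y, is_wiener_integral Phi a b Y &
      (mean_square_dist X Y < e%:E)%E.

(* t |-> u (wshift t w) is a continuous mild solution of
   du = (A u + F u) dt + sigma dW on the whole time axis, S being the group
   generated by A. *)
Definition stationary_solution (S : R -> {linear H -> H}) (F : H -> H)
    (sigma : R) (u : path0 H -> H) : Prop :=
  [/\ borel_measurable u,
      \forall w \ae Pr, continuous (fun t => u (wshift t w)) &
      forall s t, s <= t -> exists2 X,
        is_wiener_integral (fun r => S (t - r)) s t X &
        \forall w \ae Pr, exists2 v,
          is_integral `[s, t] (fun r => S (t - r) (F (u (wshift r w)))) v &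
          u (wshift t w) = S (t - s) (u (wshift s w)) + v + sigma *: X w].

Definition unique_stationary_solution (S : R -> {linear H -> H}) (F : H -> H)
    (sigma : R) (u : path0 H -> H) : Prop :=
  stationary_solution S F sigma u /\
  forall v, stationary_solution S F sigma v -> \forall w \ae Pr, v w = u w.

End WienerIntegral.

Section Dichotomy.
Context {R : realType} {H : completeNormedModType R}.

Definition strongly_continuous_group (S : R -> {linear H -> H}) : Prop :=
  [/\ forall t, continuous (S t),
      forall x, S 0 x = x,
      forall s t x, S (s + t) x = S s (S t x) &
      forall x, continuous (fun t => S t x)].

(* A, with domain D, is the infinitesimal generator of (S t)_{t >= 0}; the
   values of A outside D are irrelevant. *)
Definition is_generator (S : R -> {linear H -> H}) (D : set H) (A : H -> H) :=
  forall x y, (D x /\ A x = y) <->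
    (h^-1 *: (S h x - x) @[h --> (0 : R)^'+] --> y).

(* Each [S t] being linear and continuous with continuous inverse [S (- t)],
   bijectivity on the range of P is all that is needed for an isomorphism. *)
Definition exponential_dichotomy (S : R -> {linear H -> H})
    (P : {linear H -> H}) (alpha beta K : R) : Prop :=
  [/\ [/\ beta < alpha, alpha < 0 & 0 < K],
      continuous P /\ (forall x, P (P x) = P x),
      forall t x, P (S t x) = S t (P x),
      forall t, 0 <= t -> set_bij (range P) (range P) (S t) &
      (forall t x, t <= 0 -> `|S t (P x)| <= K * expR (alpha * t) * `|x|) /\
      (forall t x, 0 <= t ->
         `|S t (x - P x)| <= K * expR (beta * t) * `|x|)].

Definition gap_condition (alpha beta eta K LF : R) : Prop :=
  [/\ eta < 0, beta < eta, eta < alpha &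
      K * LF * ((alpha - eta)^-1 + (eta - beta)^-1) < 1].

End Dichotomy.

Section Manifolds.
Context {R : realType} {H : completeNormedModType R}.
Variables (S : R -> {linear H -> H}) (P : {linear H -> H}) (eta : R).

(* The space C^-_{eta,H}; only the values of U on (-oo, 0] matter. *)
Definition Cminus (U : R -> H) : Prop :=
  {within `]-oo, 0], continuous U} /\
  exists B : R, forall t, t <= 0 -> expR (- (eta * t)) * `|U t| <= B.

Definition lyapunov_perron (x0 : H) (G : R -> H -> H) (U : R -> H) : Prop :=
  Cminus U /\
  forall t, t <= 0 -> exists v1 v2 : H,
    [/\ is_oriented_integral 0 t (fun s => S (t - s) (P (G s (U s)))) v1,
        is_integral `]-oo, t]
          (fun s => S (t - s) (G s (U s) - P (G s (U s)))) v2 &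
        U t = S t x0 + v1 + v2].

Variable F : H -> H.

(* In both manifolds the solution attached to xi is referred to through the
   equation it solves; under the gap condition it is unique on (-oo, 0]. *)

Definition is_Ubar (u : path0 H -> H) (w : path0 H) (xi : H) :
    (R -> H) -> Prop :=
  lyapunov_perron (xi - P (u (wshift 0 w)))
    (fun s x => F (x + u (wshift s w)) - F (u (wshift s w))).

Definition manifold (u : path0 H -> H) (w : path0 H) : set H :=
  [set x | exists xi U,
     [/\ range P xi, is_Ubar u w xi U & x = U 0 + u w]].

Definition is_Vtilde (z : path0 H -> H) (w : path0 H) (xi : H) :
    (R -> H) -> Prop :=
  lyapunov_perron (xi - P (z (wshift 0 w))) (fun s x => F (x + z (wshift s w))).

(* V 0 - P (V 0) is the value h~(xi, w) of the graph map. *)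
Definition manifold_tilde (z : path0 H -> H) (w : path0 H) : set H :=
  [set x | exists xi V,
     [/\ range P xi, is_Vtilde z w xi V &
         x = xi - P (z (wshift 0 w)) + (V 0 - P (V 0))]].

End Manifolds.

(* Main.v *)
(* Along the shift flow, d = ustar - zstar satisfies, for almost every path and all
   s <= t, the noise-free mild equation
     d(t) = S(t - s) d(s) + int_s^t S(t - r) F(ustar(r)) dr,
   since the Wiener integrals of the two stationary solutions cancel.  If d lies
   in C^-_{eta,H}, letting s tend to -oo in the Q-component shows that d itself
   solves the Lyapunov-Perron equation with forcing F(ustar) and initial value
   P d(0).  Adding and subtracting d then exchanges the solutions of the two
   Lyapunov-Perron equations, and P V(0) = xi - P zstar(0) turns the graph
   description of the second manifold into {V(0)}.

   No moment of ustar is assumed, so the membership of d in C^-_{eta,H} comes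
   from stationarity: the shift preserves the Wiener measure, over a short time
   step the logarithm of 1 + |ustar| + |zstar| + int |zstar| increases by at most
   an integrable quantity, and a stationary sequence whose increments have
   integrable upper bounds grows at most linearly with arbitrarily small slope
   (truncation and the maximal ergodic inequality).  The integral of |zstar| over
   one step is written as a limit of Riemann sums, so that Fatou's lemma bounds
   its expectation without joint measurability. *)
Require Import Defs.
From HB Require Import structures.
From mathcomp Require Import all_boot all_order all_algebra.
From mathcomp Require Import all_classical all_reals all_analysis.
From mathcomp Require Import measurable_realfun ring lra.

Set Implicit Arguments.
Unset Strict Implicit.
Unset Printing Implicit Defensive.

Import Order.TTheory GRing.Theory Num.Theory.
Import numFieldNormedType.Exports.

Local Open Scope classical_set_scope.
Local Open Scope ring_scope.

(** * Measurability in separable spaces *)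

Section BorelMeasurability.
Context {R : realType} {H : completeNormedModType R}.

Lemma separable_dense_seq : separable H ->
  exists e : nat -> H, forall x (r : R), 0 < r -> exists n, `|e n - x| < r.
Proof.
move=> [D /countable_injP[f fI] dD].
exists (fun n => xget 0 [set d | D d /\ f d = n]) => x r r0.
have [y [+ Dy]] : ball x r `&` D !=set0.
  by apply: dD; [exists x; exact: ballxx|exact: ball_open].
rewrite -ball_normE /= => xy; exists (f y).
case: xgetP => [z _ [Dz fzy]|/(_ y) /= []//].
by rewrite (fI z y) ?inE// distrC.
Qed.

Context d (T : measurableType d).
Implicit Types X Y : T -> H.

Lemma measurable_borelP X :
  (forall V : set H, open V -> measurable (X @^-1` V)) ->
  measurable_fun setT (X : T -> borel H).
Proof.
move=> mX; apply: (@measurability _ _ T (borel H) setT X (@open H)) => //.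
by move=> _ [V oV <-]; rewrite setTI; exact: mX.
Qed.

Lemma measurable_borel_preimage X (B : set H) :
  measurable_fun setT (X : T -> borel H) -> measurable (B : set (borel H)) ->
  measurable (X @^-1` B).
Proof. by move=> mX mB; rewrite -[X in measurable X]setTI; exact: mX. Qed.

Lemma open_borel (V : set H) : open V -> measurable (V : set (borel H)).
Proof. by move=> oV; exact: sub_sigma_algebra. Qed.

Lemma measurable_borel_continuous X (f : H -> H) : continuous f ->
  measurable_fun setT (X : T -> borel H) ->
  measurable_fun setT (f \o X : T -> borel H).
Proof.
move=> cf mX; apply: measurable_borelP => V oV.
rewrite comp_preimage; apply: measurable_borel_preimage => //.
by apply: open_borel; exact: open_comp.
Qed.

Hypothesis sepH : separable H.

(** A continuous [op] need not be measurable for a product of Borel sigma-algebras in general.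
    Separability rescues this: the preimage of an open set is a countable union of products of balls
    whose centres run through a dense sequence and whose radii are [k.+1%:R^-1]. *)
Lemma measurable_borel_op2 (op : H -> H -> H) X Y :
  continuous (fun p : H * H => op p.1 p.2) ->
  measurable_fun setT (X : T -> borel H) ->
  measurable_fun setT (Y : T -> borel H) ->
  measurable_fun setT ((fun t => op (X t) (Y t)) : T -> borel H).
Proof.
have [e eP] := separable_dense_seq sepH.
move=> cop mX mY; apply: measurable_borelP => V oV.
pose U (i : nat * nat * nat) (x y : H) :=
  ball (e i.1.1) i.2.+1%:R^-1 x /\ ball (e i.1.2) i.2.+1%:R^-1 y.
pose F i := [set t | U i (X t) (Y t) /\ forall x y, U i x y -> V (op x y)].
have -> : (fun t => op (X t) (Y t)) @^-1` V = \bigcup_i F i.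
  apply/seteqP; split => [t /= Vt|t [i _ [Ut UO]]]; last exact: UO.
  have := cop (X t, Y t); move/(_ V) => /(_ (open_nbhs_nbhs (conj oV Vt))).
  move=> /nbhs_ballP[r /= r0 rO].
  have [k kr] : exists k, k.+1%:R^-1 < r / 2.
    have r20 : 0 < r / 2 by rewrite divr_gt0.
    have [k] := ltr_add_invr r20.
    by rewrite add0r => ?; exists k.
  have k0 : 0 < k.+1%:R^-1 :> R by rewrite invr_gt0.
  have [i iX] := eP (X t) _ k0.
  have [j jY] := eP (Y t) _ k0.
  exists (i, j, k) => //; split.
    by split; rewrite -ball_normE.
  move=> x y [/=]; rewrite -!ball_normE /= => ix jy.
  apply: (rO (x, y)); split => /=; rewrite -ball_normE /=.
    rewrite (splitr r); apply: le_lt_trans (ler_distD (e i) _ _) _.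
    by rewrite ltrD// ?(lt_trans _ kr)// distrC.
  rewrite (splitr r); apply: le_lt_trans (ler_distD (e j) _ _) _.
  by rewrite ltrD// ?(lt_trans _ kr)// distrC.
apply: countable_bigcupT_measurable => [|i]; first exact: countableP.
(* The condition that [op] maps the two balls into [V] does not depend on the sample point, so [F i]
   is either the full preimage of the pair of balls or empty. *)
have [UO|nUO] := pselect (forall x y, U i x y -> V (op x y)).
  have -> : F i = X @^-1` ball (e i.1.1) i.2.+1%:R^-1 `&`
                  Y @^-1` ball (e i.1.2) i.2.+1%:R^-1.
    by apply/seteqP; split => t => [[]//|?]; split.
  by apply: measurableI; apply: measurable_borel_preimage => //;
    apply: open_borel; exact: ball_open.
by rewrite (_ : F i = set0)//; apply/seteqP; split => t // [].
Qed.

Lemma measurable_borelD X Y :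
  measurable_fun setT (X : T -> borel H) ->
  measurable_fun setT (Y : T -> borel H) ->
  measurable_fun setT ((fun t => X t + Y t) : T -> borel H).
Proof. by apply: measurable_borel_op2 => p; exact: add_continuous. Qed.

Lemma measurable_borelB X Y :
  measurable_fun setT (X : T -> borel H) ->
  measurable_fun setT (Y : T -> borel H) ->
  measurable_fun setT ((fun t => X t - Y t) : T -> borel H).
Proof.
move=> mX mY; apply: measurable_borelD => //.
by apply: (@measurable_borel_continuous Y -%R) => //; exact: opp_continuous.
Qed.

Lemma measurable_borel_norm X :
  measurable_fun setT (X : T -> borel H) ->
  measurable_fun setT (fun t => `|X t|).
Proof.
move=> mX; apply: (measurability _ (measurable_realfun.RGenOInfty.measurableE R)).
move=> _ [_ [r ->] <-]; rewrite setTI.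
rewrite (_ : _ @^-1` _ = X @^-1` ((fun x : H => `|x|) @^-1` `]r, +oo[))//.
apply: measurable_borel_preimage => //; apply: open_borel.
by apply: open_comp => [x _|]; [exact: norm_continuous|exact: interval_open].
Qed.

End BorelMeasurability.

(** * Invariance of the Wiener measure under the shift *)

Section WienerShift.
Context {R : realType} {H : completeNormedModType R}.
Hypothesis sepH : separable H.
Implicit Types (w : path0 H) (s t tau : R).

Lemma measurable_coord t :
  measurable_fun setT ((fun w : path0 H => w t) : wienerSpace H -> borel H).
Proof.
apply: (@measurable_borelP _ _ _ (wienerSpace H)) => V oV.
by apply: sub_sigma_algebra; exists t, V.
Qed.

Lemma measurable_increment s t (B : set H) :
  measurable (B : set (borel H)) -> measurable (increment s t B).
Proof.
move=> mB; apply: (@measurable_borel_preimage _ _ _ (wienerSpace H)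
  (fun w : path0 H => w t - w s)) => //.
by apply: (@measurable_borelB _ _ _ (wienerSpace H)) => //; exact: measurable_coord.
Qed.

Lemma measurable_wshift tau :
  measurable_fun setT (wshift tau : wienerSpace H -> wienerSpace H).
Proof.
apply: (@measurability _ _ (wienerSpace H) (wienerSpace H) setT (wshift tau)
  (@cylinders _ H)) => //.
move=> _ [_ [t [V [oV ->]]] <-]; rewrite setTI.
by apply: (@measurable_increment tau (t + tau)); exact: open_borel.
Qed.

Lemma wshift_ext w w' : (forall t, w t = w' t) -> w = w'.
Proof.
case: w w' => [f cf f0] [g cg g0] /= /funext fg.
by subst g; rewrite (Prop_irrelevance cf cg) (Prop_irrelevance f0 g0).
Qed.

Lemma wshiftD s t w : wshift s (wshift t w) = wshift (s + t) w.
Proof.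
apply: wshift_ext => r /=; rewrite opprB addrA [_ - w t + w t]addrNK.
by rewrite addrA.
Qed.

Lemma wshift0 w : wshift 0 w = w.
Proof. by apply: wshift_ext => r /=; rewrite path_0 subr0 addr0. Qed.

Section Invariance.
Variables (ip : {dot H for @idfun R}) (C : {linear H -> H}).
Variable Pr : probability (wienerSpace H) R.
Hypothesis hPr : wiener_measure ip C Pr.
Variable tau : R.

Let Pt : {measure set (wienerSpace H) -> \bar R} :=
  measure_function_pushforward__canonical__measure_function_Measure Pr
    (measurable_wshift tau).

Let PtE B : Pt B = Pr (wshift tau @^-1` B).
Proof. by []. Qed.

Lemma increment_wshift s t B :
  wshift tau @^-1` (increment s t B) = increment (s + tau) (t + tau) B
  :> set (path0 H).
Proof.
by apply/seteqP; split => w; rewrite /increment /=;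
  rewrite opprB addrA [_ - w tau + w tau]addrNK.
Qed.

Lemma increment_same s B : increment s s B = [set _ | B 0] :> set (path0 H).
Proof. by apply/seteqP; split => w; rewrite /increment /= subrr. Qed.

(** The law of an increment depends on [t - s] only. It is prescribed for [s < t]; for [s = t] the
    increment is 0 on every path. *)
Lemma increment_law_invariant s t (B : set (borel H)) : s <= t -> measurable B ->
  Pr (increment (s + tau) (t + tau) B) = Pr (increment s t B).
Proof.
case: hPr => -[N [_ NP]] _; rewrite le_eqVlt => /predU1P[->|st] mB.
  by rewrite !increment_same.
by rewrite !NP// ?ltrD2r// opprD addrACA subrr addr0.
Qed.

Definition rectangle (n : nat) (t : nat -> R) (B : nat -> set (borel H)) :
  set (wienerSpace H) := \bigcap_(i < n) increment (t i) (t i.+1) (B i).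

Lemma rectangle_wshift n (t : nat -> R) B :
  wshift tau @^-1` (rectangle n t B) = rectangle n (fun i => t i + tau) B.
Proof.
rewrite /rectangle preimage_bigcap; apply: eq_bigcapr => i _.
exact: increment_wshift.
Qed.

Lemma measure_rectangle n (t : nat -> R) (B : nat -> set (borel H)) :
  (forall i, t i <= t i.+1) -> (forall i, measurable (B i)) ->
  Pt (rectangle n t B) = Pr (rectangle n t B).
Proof.
move=> tn mB; rewrite PtE rectangle_wshift /rectangle.
case: (hPr) => _ ind; rewrite !ind// => [|i]; last by rewrite lerD2r.
by apply: eq_bigr => i _; exact: increment_law_invariant.
Qed.

Definition grid_rectangles (n : nat) (t : nat -> R) :=
  [set A | exists2 B : nat -> set (borel H), forall i, measurable (B i) &
    A = rectangle n t B].

Lemma measurable_rectangle n (t : nat -> R) (B : nat -> set (borel H)) :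
  (forall i, measurable (B i)) -> measurable (rectangle n t B).
Proof.
by move=> mB; apply: bigcap_measurableType => // i _; exact: measurable_increment.
Qed.

(** On a fixed grid the rectangles are closed under intersection, so the pi-lambda theorem extends
    the equality from rectangles, where independence of increments gives it, to the sigma-algebra
    they generate. *)
Lemma measure_grid n (t : nat -> R) : (forall i, t i <= t i.+1) ->
  forall A, <<s grid_rectangles n t >> A -> Pt A = Pr A.
Proof.
move=> tn; apply: (@g_sigma_algebra_measure_unique _ _ (wienerSpace H) _ _
  (fun=> setT) _ _ Pt Pr).
- by move=> _ [B mB ->]; exact: measurable_rectangle.
- move=> _; exists (fun=> setT); first by move=> i; exact: measurableT.
  by apply/esym/seteqP; split => // w _ i _.
- by rewrite bigcup_const//; exists 0%N.
- move=> _ _ [B mB ->] [B' mB' ->]; exists (fun i => B i `&` B' i).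
    by move=> i; exact: measurableI.
  by rewrite /rectangle -bigcapI.
- by move=> _ [B mB ->]; exact: measure_rectangle.
- move=> _; rewrite PtE preimage_setT; apply: le_lt_trans (probability_le1 Pr _) _.
    exact: measurableT.
  exact: ltry.
Qed.

Definition coord_sets (s : seq R) : set (set (wienerSpace H)) :=
  [set A | exists t (V : set H), [/\ t \in s, open V &
    A = [set w : path0 H | V (w t)]]].

(** Since paths vanish at time 0, each coordinate is a difference of two sums of increments as soon
    as the grid contains 0 and the times in [s]. *)
Lemma coord_sets_grid (s : seq R) : exists n (t : nat -> R),
  (forall i, t i <= t i.+1) /\ coord_sets s `<=` <<s grid_rectangles n t >>.
Proof.
(* The default value is the last time, so the grid is constant past its end and [t] is nondecreasing
   on all of [nat]. *)
pose r := sort <=%R (0 :: s); pose t i := nth (last 0 r) r i.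
have rs : sorted <=%R r by exact: (sort_sorted le_total).
have t_le i : t i <= t i.+1.
  have [lt_i|ge_i] := ltnP i.+1 (size r).
    by rewrite /t; apply: (sorted_leq_nth le_trans lexx) => //;
      rewrite ?inE ?(ltnW lt_i).
  rewrite /t [leRHS]nth_default//.
  have [lt_i|ge_i'] := ltnP i (size r); last by rewrite nth_default.
  have sr : size r = i.+1 by apply/eqP; rewrite eqn_leq ge_i.
  by rewrite (_ : nth _ r i = last 0 r)// -nth_last sr; exact: set_nth_default.
exists (size r), t; split => // _ [q [V [qs oV ->]]].
set G := grid_rectangles (size r) t.
have inc i : (i < size r)%N ->
    measurable_fun setT ((fun w : path0 H => w (t i.+1) - w (t i)) :
      g_sigma_algebraType G -> borel H).
  move=> lti; apply: (@measurable_borelP _ _ _ (g_sigma_algebraType G)) => V' oV'.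
  apply: sub_sigma_algebra; exists (fun j => if j == i then V' else setT).
    by move=> j; case: ifP => // _; exact: open_borel.
  apply/seteqP; split => w /=.
    by move=> ? j _; rewrite /increment /=; case: eqP => // ->.
  by move=> /(_ i lti); rewrite /increment /= eqxx.
have val i : (i <= size r)%N ->
    measurable_fun setT ((fun w : path0 H => w (t i) - w (t 0%N)) :
      g_sigma_algebraType G -> borel H).
  elim: i => [_|i IH lti].
    under eq_fun do rewrite subrr; exact: measurable_cst.
  rewrite (_ : (fun _ => _) = fun w : path0 H =>
      (w (t i.+1) - w (t i)) + (w (t i) - w (t 0%N))); last first.
    by apply/funext => w; rewrite addrA subrK.
  by apply: (@measurable_borelD _ _ _ (g_sigma_algebraType G)) => //;
    [exact: inc|exact: (IH (ltnW lti))].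
have mem x : x \in 0 :: s -> exists2 i, (i < size r)%N & t i = x.
  move=> xs; have xr : x \in r by rewrite mem_sort.
  by exists (index x r); rewrite ?index_mem// /t nth_index.
have [i li ti] := mem q (mem_behead (s := 0 :: s) qs).
have [j lj tj] := mem 0 (mem_head 0 s).
apply: (@measurable_borel_preimage _ _ _ (g_sigma_algebraType G)
  (fun w : path0 H => w q)); last exact: open_borel.
(* Here [t i = q] and [t j = 0]; sums of increments start at [t 0%N], which may be negative, hence
   the subtraction. *)
rewrite (_ : (fun _ => _) = fun w : path0 H =>
    (w (t i) - w (t 0%N)) - (w (t j) - w (t 0%N))); last first.
  by apply/funext => w; rewrite opprB addrA subrK ti tj path_0 subr0.
by apply: (@measurable_borelB _ _ _ (g_sigma_algebraType G)) => //;
  apply: val; exact: ltnW.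
Qed.

(** A second pi-lambda argument: events depending on finitely many coordinates are closed under
    intersection, by concatenating the lists of times, and generate the whole sigma-algebra. On each
    of them invariance comes from a suitable grid. *)
Lemma wiener_measure_wshift (A : set (wienerSpace H)) : measurable A ->
  Pr (wshift tau @^-1` A) = Pr A.
Proof.
pose G := [set A : set (wienerSpace H) | exists s : seq R, <<s coord_sets s >> A].
have coord_sub (s s' : seq R) : {subset s <= s'} -> coord_sets s `<=` coord_sets s'.
  by move=> ss' _ [t [V [ts oV ->]]]; exists t, V; split => //; exact: ss'.
have sG (s : seq R) : <<s coord_sets s >> `<=` (measurable : set (set (wienerSpace H))).
  apply: smallest_sub; first exact: sigma_algebra_measurable.
  by move=> _ [t [V [_ oV ->]]]; apply: sub_sigma_algebra; exists t, V.
move=> mA; rewrite -PtE.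
apply: (@g_sigma_algebra_measure_unique _ _ (wienerSpace H) G _
  (fun=> setT) _ _ Pt Pr).
- by move=> B [s]; exact: sG.
- by move=> _; exists [::]; exact: (@measurableT _ (g_sigma_algebraType _)).
- by rewrite bigcup_const//; exists 0%N.
- move=> B B' [s sB] [s' sB']; exists (s ++ s').
  apply: (@measurableI _ (g_sigma_algebraType (coord_sets (s ++ s')))).
    apply: (@sub_smallest2r _ _ _ _ _ _ _ sB); first exact: smallest_sigma_algebra.
    by apply: coord_sub => x xs; rewrite mem_cat xs.
  apply: (@sub_smallest2r _ _ _ _ _ _ _ sB'); first exact: smallest_sigma_algebra.
  by apply: coord_sub => x xs; rewrite mem_cat xs orbT.
- move=> B [s sB]; have [n [t [tn ts]]] := coord_sets_grid s.
  apply: (measure_grid tn).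
  by apply: (@smallest_sub _ _ _ _ _ ts _ sB); exact: smallest_sigma_algebra.
- move=> _; rewrite PtE preimage_setT; apply: le_lt_trans (probability_le1 Pr _) _.
    exact: measurableT.
  exact: ltry.
- apply: (@sub_smallest2r _ _ _ _ _ _ _ mA); first exact: smallest_sigma_algebra.
  move=> _ [t [V [oV ->]]]; exists [:: t]; apply: sub_sigma_algebra.
  by exists t, V; split; rewrite ?inE.
Qed.

End Invariance.
End WienerShift.

(** * Uniqueness of Wiener integrals *)

Section WienerIntegralUniqueness.
Context {R : realType} {H : completeNormedModType R}.
Hypothesis sepH : separable H.
Variable Pr : probability (wienerSpace H) R.
Implicit Types X Y : path0 H -> H.

Lemma measurable_wiener_sum (Phi : R -> H -> H) n (t : nat -> R) :
  (forall r, continuous (Phi r)) -> borel_measurable (wiener_sum Phi n t).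
Proof.
move=> cPhi; elim: n => [|n IH].
  rewrite /borel_measurable (_ : wiener_sum _ _ _ = fun=> 0); last first.
    by apply/funext => w; rewrite /wiener_sum big_ord0.
  exact: measurable_cst.
rewrite /borel_measurable (_ : wiener_sum _ _ _ = fun w : path0 H =>
    wiener_sum Phi n t w + Phi (t n) (w (t n.+1) - w (t n))); last first.
  by apply/funext => w; rewrite /wiener_sum big_ord_recr.
apply: (@measurable_borelD _ _ _ (wienerSpace H)) => //.
apply: (@measurable_borel_continuous _ _ _ (wienerSpace H)
  (fun w : path0 H => w (t n.+1) - w (t n)) (Phi (t n))) => //.
by apply: (@measurable_borelB _ _ _ (wienerSpace H)) => //; exact: measurable_coord.
Qed.

Lemma measurable_sqdist X Y : borel_measurable X -> borel_measurable Y ->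
  measurable_fun setT ((fun w => (`|X w - Y w| ^+ 2)%:E) : wienerSpace H -> \bar R).
Proof.
move=> mX mY; apply/measurable_EFinP; apply: measurable_funX.
apply: (@measurable_borel_norm _ _ _ (wienerSpace H)).
exact: (@measurable_borelB _ _ _ (wienerSpace H)).
Qed.

Lemma mean_square_dist_triangle X Y Z :
  borel_measurable X -> borel_measurable Y -> borel_measurable Z ->
  (mean_square_dist Pr X Y <=
   2%:E * (mean_square_dist Pr X Z + mean_square_dist Pr Y Z))%E.
Proof.
move=> mX mY mZ; have mXZ := measurable_sqdist mX mZ.
have mYZ := measurable_sqdist mY mZ.
rewrite /mean_square_dist -ge0_integralD//.
rewrite -ge0_integralZl_EFin//; last 2 first.
- by move=> w _; rewrite adde_ge0// lee_fin exprn_ge0.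
- exact: emeasurable_funD.
apply: ge0_le_integral => //.
- exact: measurable_sqdist.
- by apply: measurable_funeM; exact: emeasurable_funD.
move=> w _; rewrite -EFinD -EFinM lee_fin.
have : `|X w - Y w| <= `|X w - Z w| + `|Y w - Z w|.
  by rewrite (distrC (Y w)); exact: ler_distD.
set p := `|X w - Z w|; set q := `|Y w - Z w| => le_pq.
apply: (@le_trans _ _ ((p + q) ^+ 2)).
  by rewrite lerXn2r// nnegrE// addr_ge0 /p /q.
rewrite -subr_ge0 (_ : _ - _ = (p - q) ^+ 2) ?sqr_ge0//; ring.
Qed.

Lemma fine_partition (a b delta : R) : a <= b -> 0 < delta ->
  exists n t, partition_mesh a b delta n t.
Proof.
move=> ab delta0; pose k := (Num.truncn ((b - a) / delta)).+1.
have k0 : 0 < k%:R :> R by rewrite ltr0n.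
exists k, (fun i => a + i%:R * ((b - a) / k%:R)); split.
- by rewrite mul0r addr0.
- by rewrite mulrCA divff ?gt_eqF// mulr1 addrC subrK.
move=> i _; have ba0 : 0 <= b - a by rewrite subr_ge0.
rewrite -(@natr1 R i) [(_ + 1) * _]mulrDl mul1r addrA; split.
  by rewrite lerDl divr_ge0// ltW.
rewrite [X in X < _]addrC addKr ltr_pdivrMr// mulrC -ltr_pdivrMr//.
exact: truncnS_gt.
Qed.

(** Both integrals are mean-square close to the same sum over a common fine partition, so their
    mean-square distance is 0. The constant [e / 4] offsets the factor 2 in the quadratic triangle
    inequality and the two summands. *)
Lemma wiener_integral_unique (Phi : R -> H -> H) (a b : R) X Y : a <= b ->
  (forall r, continuous (Phi r)) ->
  is_wiener_integral Pr Phi a b X -> is_wiener_integral Pr Phi a b Y ->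
  \forall w \ae Pr, X w = Y w.
Proof.
move=> ab cPhi [[mX _] limX] [[mY _] limY].
have d0 : mean_square_dist Pr X Y = 0%E.
  apply/eqP; rewrite eq_le integral_ge0 ?andbT//.
  apply/lee_addgt0Pr => e e0; rewrite add0e.
  have e40 : 0 < e / 4 by rewrite divr_gt0.
  have [d1 d10 D1] := limX _ e40; have [d2 d20 D2] := limY _ e40.
  have d0 : 0 < Num.min d1 d2 by rewrite lt_min d10.
  have [n [t [t0 tn tm]]] := fine_partition ab d0.
  have m1 : partition_mesh a b d1 n t.
    by split=> // i /tm[? ]; rewrite lt_min => /andP[].
  have m2 : partition_mesh a b d2 n t.
    by split=> // i /tm[? ]; rewrite lt_min => /andP[].
  apply: le_trans (mean_square_dist_triangle mX mY
    (measurable_wiener_sum n t cPhi)) _.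
  rewrite (_ : e%:E = (2%:E * ((e / 4)%:E + (e / 4)%:E))%E); last first.
    by rewrite -EFinD -EFinM; congr EFin; field.
  by rewrite lee_pmul2l// leeD// ltW// ?D1 ?D2.
have /ae_eq_integral_abs : measurable_fun setT
    ((fun w => (`|X w - Y w| ^+ 2)%:E) : wienerSpace H -> \bar R).
  exact: measurable_sqdist.
move=> /(_ Pr measurableT)[+ _].
under eq_integral do rewrite gee0_abs ?lee_fin ?exprn_ge0//.
move=> /(_ d0); apply: filterS => w /(_ I) /eqP.
by rewrite eqe expf_eq0/= normr_eq0 subr_eq0 => /eqP.
Qed.

End WienerIntegralUniqueness.

(** * Weak integrals *)

Section WeakIntegral.
Context {R : realType} {H : completeNormedModType R}.
Variable ip : {dot H for @idfun R}.
Hypothesis hH : hilbert ip.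

Lemma ip_sym x y : ip x y = ip y x.
Proof. by rewrite hermC expr0 mul1r. Qed.

Lemma ipDr x y z : ip x (y + z) = ip x y + ip x z.
Proof. exact: linearDr. Qed.

Lemma ipDl x y z : ip (x + y) z = ip x z + ip y z.
Proof. by rewrite !(ip_sym _ z) ipDr. Qed.

Lemma ipZl a x y : ip (a *: x) y = a * ip x y.
Proof. by rewrite !(ip_sym _ y); exact: linearZr. Qed.

Lemma ipBl x y z : ip (x - y) z = ip x z - ip y z.
Proof. by rewrite ipDl -scaleN1r ipZl mulN1r. Qed.

(** Cauchy-Schwarz is read off from the triangle inequality of the norm: squaring
    [|u + v| <= |u| + |v|] and expanding leaves the inner product. The absolute value follows by
    replacing [x] with [- x]. *)
Lemma norm_ip_le x y : `|ip x y| <= `|x| * `|y|.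
Proof.
suff ub u v : ip u v <= `|u| * `|v|.
  rewrite ler_norml ub andbT lerNl -(normrN x) -mulN1r -ipZl scaleN1r.
  exact: ub.
have := ler_normD u v; rewrite -(@ler_sqr _ `|u + v|) ?nnegrE ?addr_ge0//.
rewrite -hH ipDr !ipDl !hH (ip_sym v u) sqrrD; lra.
Qed.

Let ipr (v : H) : H -> R^o := fun x => ip x v.

Let ipr_linear v : linear (ipr v).
Proof. by move=> a x y; rewrite /ipr ipDl ipZl. Qed.

HB.instance Definition _ v := GRing.isLinear.Build R H R^o _ (ipr v) (ipr_linear v).

Definition ip_functional (v : H) : {linear H -> R^o} := ipr v.

Lemma ip_functional_continuous v : continuous (ip_functional v).
Proof.
apply: bounded_linear_continuous; apply/linear_boundedP; 
apply: filterS (nbhs_pinfty_ge (num_real `|v|)) => r /= vr x.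
by apply: le_trans (norm_ip_le _ _) _; rewrite mulrC ler_wpM2r.
Qed.

(** Testing with the functional [ip _ (x - y)] gives that the square of the norm of [x - y]
    vanishes. *)
Lemma weak_separation (x y : H) :
  (forall phi : {linear H -> R^o}, continuous phi -> phi x = phi y) -> x = y.
Proof.
move=> /(_ _ (@ip_functional_continuous (x - y))) /= xy.
apply/eqP; rewrite -subr_eq0 -normr_eq0 -sqrf_eq0 -hH.
by rewrite ipBl subr_eq0; apply/eqP.
Qed.

(** The value is known only through functionals, so it is tested against [ip _ v]; Cauchy-Schwarz
    under the integral and division by the norm of [v] finish. *)
Lemma is_integral_norm (D : set R) f (v : H) : measurable D -> is_integral D f v ->
  (`|v|%:E <= \int[lebesgue_measure]_(s in D) `|f s|%:E)%E.
Proof.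
move=> mD [intf /(_ _ (@ip_functional_continuous v))[intv /= ve]].
have [->|v0] := eqVneq v 0.
  by rewrite normr0 integral_ge0// => s _; rewrite lee_fin.
have v0' : 0 < `|v| by rewrite normr_gt0.
rewrite -(@lee_pmul2r _ `|v|%:E)// -EFinM -expr2 -hH.
rewrite -ge0_integralZr//; last by have /integrableP[] := intf.
rewrite (_ : (ip v v)%:E = \int[lebesgue_measure]_(s in D) (ip (f s) v)%:E)%E//.
apply: le_integral => //.
  have := @integrableZr _ _ R lebesgue_measure D mD `|v| _ intf.
  exact.
by move=> s _; rewrite -EFinM lee_fin; apply: le_trans (norm_ip_le _ _); exact: ler_norm.
Qed.

End WeakIntegral.

Section IntegralCalculus.
Context {R : realType} {H : completeNormedModType R}.
Implicit Types (D : set R) (f g : R -> H).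

Lemma continuous_linear_boundP (V : normedModType R) (L : {linear H -> V}) :
  continuous L -> exists2 C : R, 0 < C & forall x, `|L x| <= C * `|x|.
Proof.
move=> /(_ 0)/(continuous_linear_bounded 0)/linear_boundedP/pinfty_ex_gt0.
by move=> [C C0 LC]; exists C.
Qed.

Lemma within_continuous_postcomp (V W : topologicalType) D (f : R -> V) (L : V -> W) :
  continuous L -> {within D, continuous f} ->
  {within D, continuous (fun s => L (f s))}.
Proof. by move=> cL cf x; apply: continuous_comp; [exact: cf|exact: cL]. Qed.

Lemma measurable_norm_within D f : measurable D -> {within D, continuous f} ->
  measurable_fun D (fun s => `|f s|).
Proof.
move=> mD cf; apply: (@subspace_continuous_measurable_fun R D (fun s => `|f s|)) => //.
by move=> x; apply: continuous_comp; [exact: cf|exact: norm_continuous].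
Qed.

Lemma measurable_linear_within D f (phi : {linear H -> R^o}) : continuous phi ->
  measurable D -> {within D, continuous f} ->
  measurable_fun D (fun s => phi (f s) : R).
Proof.
move=> cphi mD cf.
apply: (@subspace_continuous_measurable_fun R D (fun s => phi (f s))) => //.
by move=> x; apply: continuous_comp; [exact: cf|exact: cphi].
Qed.

Lemma integrable_norm_le D f (b : R -> R) : measurable D ->
  {within D, continuous f} -> lebesgue_measure.-integrable D (EFin \o b) ->
  (forall s, D s -> `|f s| <= b s) ->
  lebesgue_measure.-integrable D (fun s => `|f s|%:E).
Proof.
move=> mD cf ib fb; apply: le_integrable ib => //.
  by apply/measurable_EFinP; exact: measurable_norm_within.
move=> s Ds; rewrite /= lee_fin normr_id.
by apply: le_trans (fb _ Ds) _; exact: ler_norm.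
Qed.

Lemma integrable_linear D f (phi : {linear H -> R^o}) : measurable D ->
  {within D, continuous f} -> continuous phi ->
  lebesgue_measure.-integrable D (fun s => `|f s|%:E) ->
  lebesgue_measure.-integrable D (fun s => (phi (f s))%:E).
Proof.
move=> mD cf cphi If; have [C C0 Cphi] := continuous_linear_boundP cphi.
have I2 := @integrableZl _ _ R lebesgue_measure D mD C _ If.
apply: (@le_integrable _ _ R lebesgue_measure D mD _ _ _ _ I2) => //.
  by apply/measurable_EFinP; exact: measurable_linear_within.
move=> s Ds; rewrite !abse_EFin lee_fin.
by apply: le_trans (Cphi _) _; exact: ler_norm.
Qed.

Lemma is_integral_intro D f (v : H) : measurable D ->
  {within D, continuous f} ->
  lebesgue_measure.-integrable D (fun s => `|f s|%:E) ->
  (forall phi : {linear H -> R^o}, continuous phi ->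
    ((phi v)%:E = \int[lebesgue_measure]_(s in D) (phi (f s))%:E)%E) ->
  is_integral D f v.
Proof.
move=> mD cf If vE; split=> // phi cphi.
by split; [exact: (integrable_linear mD cf cphi If)|exact: vE].
Qed.

Lemma eq_is_integral D f g (v : H) : measurable D -> (forall s, D s -> f s = g s) ->
  is_integral D f v -> is_integral D g v.
Proof.
move=> mD fg [If vE]; split.
  by apply: eq_integrable If => // s; rewrite inE => Ds; rewrite fg.
move=> phi /vE[Iphi ve]; split.
  by apply: eq_integrable Iphi => // s; rewrite inE => Ds; rewrite fg.
by rewrite ve; apply: eq_integral => s; rewrite inE => Ds; rewrite fg.
Qed.

(** A functional composed with [L] is again a continuous functional, so the weak characterisation of
    [v] applies to it directly. *)
Lemma is_integral_linear D f (v : H) (L : {linear H -> H}) : measurable D ->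
  continuous L -> {within D, continuous f} -> is_integral D f v ->
  is_integral D (fun s => L (f s)) (L v).
Proof.
move=> mD cL cf [If vE]; have [C C0 CL] := continuous_linear_boundP cL.
have cLf : {within D, continuous (fun s => L (f s))}.
  exact: within_continuous_postcomp.
apply: is_integral_intro => //.
  apply: (integrable_norm_le (b := fun s => C * `|f s|)) => //.
  exact: (@integrableZl _ _ R lebesgue_measure D mD C _ If).
move=> phi cphi; have cphiL : continuous (phi \o L : {linear H -> R^o}).
  by move=> x; apply: continuous_comp; [exact: cL|exact: cphi].
by have [_ /= ->] := vE _ cphiL.
Qed.

(** The scalar serves to treat sums ([c = 1]) and differences ([c = -1]) at once, as both occur in
    the exchange of the two Lyapunov-Perron equations. *)
Lemma is_integral_lincomb D f g (v w : H) (c : R) : measurable D ->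
  {within D, continuous (fun s => f s + c *: g s)} ->
  is_integral D f v -> is_integral D g w ->
  is_integral D (fun s => f s + c *: g s) (v + c *: w).
Proof.
move=> mD cfg [If vE] [Ig wE]; apply: is_integral_intro => //.
  apply: (integrable_norm_le (b := fun s => `|f s| + `|c| * `|g s|)) => //.
    exact: (@integrableD _ _ R lebesgue_measure D mD (fun s => `|f s|%:E)
      (fun s => `|c|%:E * `|g s|%:E)%E If
      (@integrableZl _ _ R lebesgue_measure D mD `|c| _ Ig)).
  by move=> s _; rewrite -normrZ; exact: ler_normD.
move=> phi cphi; have [Ivf ve] := vE _ cphi; have [Iwg we] := wE _ cphi.
under eq_integral do rewrite linearD linearZ EFinD EFinM.
rewrite integralD//; last exact: integrableZl.
by rewrite integralZl// -ve -we linearD linearZ.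
Qed.

Lemma is_integral_set1 a f (v : H) (ip : {dot H for @idfun R}) : hilbert ip ->
  is_integral `[a, a] f v -> v = 0.
Proof.
move=> hH [_ vE]; apply: (weak_separation hH) => phi /vE[_].
by rewrite set_itv1 integral_set1 linear0 => -[].
Qed.

End IntegralCalculus.

(** * Maximal ergodic inequality and sublinear growth *)

Section MaximalErgodic.
Context d (T : measurableType d) (R : realType) (mu : probability T R).
Variables (th : T -> T) (mth : measurable_fun setT th).
Hypothesis th_inv : forall B, measurable B -> mu (th @^-1` B) = mu B.

Lemma ge0_integral_comp_invariant (f : T -> \bar R) :
  measurable_fun setT f -> (forall x, 0 <= f x)%E ->
  (\int[mu]_x f (th x) = \int[mu]_x f x)%E.
Proof.
move=> mf f0.
rewrite -[LHS](@ge0_integral_pushforward _ _ T T R th mth mu setT f)//.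
by apply: eq_measure_integral => B mB _; rewrite -[RHS]th_inv.
Qed.

(** This is the maximum of the Birkhoff sums of [h] with at most [n] terms, the empty sum included.
    The recursive form is the identity used in Garsia's proof of the maximal ergodic inequality. *)
Fixpoint max_sums (h : T -> R) (n : nat) (w : T) : R :=
  if n is n'.+1 then Num.max 0 (h w + max_sums h n' (th w)) else 0.

Lemma max_sums_ge0 h n w : 0 <= max_sums h n w.
Proof. by case: n => //= n; rewrite le_max lexx. Qed.

Lemma max_sums_le_succ h n w : max_sums h n w <= max_sums h n.+1 w.
Proof.
elim: n w => [|n IH] w; first exact: max_sums_ge0.
by rewrite /= ge_max !le_max lexx/= lerD2l IH orbT.
Qed.

Lemma measurable_max_sums h n :
  measurable_fun setT h -> measurable_fun setT (max_sums h n).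
Proof.
move=> mh; elim: n => [|n IH] /=; first exact: measurable_cst.
apply: measurable_maxr; first exact: measurable_cst.
apply: measurable_funD => //; exact: (measurableT_comp IH mth).
Qed.

Lemma sums_le_max_sums h n w :
  \sum_(k < n) h (iter k th w) <= max_sums h n w.
Proof.
elim: n w => [|n IH] w; first by rewrite big_ord0.
rewrite big_ord_recl /= le_max; apply/orP; right.
rewrite lerD2l; apply: le_trans (IH _); apply: ler_sum => i _.
by rewrite -iterSr.
Qed.

Variables (g : T -> R) (eps : R).
Hypotheses (mg : measurable_fun setT g) (g0 : forall w, 0 <= g w).
Hypotheses (ig : (\int[mu]_w (g w)%:E < +oo)%E) (eps0 : 0 < eps).
Let h w := g w - eps.

Let mh : measurable_fun setT h.
Proof. by apply: measurable_funB => //; exact: measurable_cst. Qed.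

Let mM n : measurable_fun setT (fun w => (max_sums h n w)%:E).
Proof. by apply/measurable_EFinP; exact: measurable_max_sums. Qed.

Let mMth n : measurable_fun setT (fun w => (max_sums h n (th w))%:E).
Proof. exact: (measurableT_comp (mM n) mth). Qed.

Let mgE : measurable_fun setT (fun w => (g w)%:E).
Proof. exact/measurable_EFinP. Qed.

(** Finiteness is what allows this integral to be cancelled in the maximal inequality. It follows by
    induction from [h <= g] and invariance. *)
Lemma integral_max_sums_lty n : (\int[mu]_w (max_sums h n w)%:E < +oo)%E.
Proof.
elim: n => [|n IH]; first by rewrite integral0.
apply: (@le_lt_trans _ _ (\int[mu]_w ((g w)%:E + (max_sums h n (th w))%:E))%E).
  apply: ge0_le_integral => //.
  - by move=> w _; rewrite lee_fin max_sums_ge0.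
  - exact: emeasurable_funD.
  - move=> w _; rewrite -EFinD lee_fin /= ge_max addr_ge0 ?max_sums_ge0//=.
    by rewrite lerD2r /h lerBlDr lerDl ltW.
rewrite ge0_integralD//; last 2 first.
- by move=> w _; rewrite lee_fin.
- by move=> w _; rewrite lee_fin max_sums_ge0.
rewrite (@ge0_integral_comp_invariant (fun w => (max_sums h n w)%:E))//.
  by rewrite lte_add_pinfty.
by move=> w; rewrite lee_fin max_sums_ge0.
Qed.

Let A n := [set w | 0 < max_sums h n w].

Let mA n : measurable (A n).
Proof.
rewrite (_ : A n = [set x | setT x /\ 0 < max_sums h n x]); last first.
  by apply/seteqP; split => x; [split|case].
have := measurable_fun_ltr (measurable_cst (0 : R)) (measurable_max_sums n mh).
move/(_ measurableT [set true]) => /(_ _) H.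
have {H} := H I; congr measurable; apply/seteqP; split => x /=; by case.
Qed.

(* With M_{n+1} the maximum of 0 and the partial sums of h, one has
   M_{n+1} + eps 1_A <= g + M_{n+1} \o th, where A = {M_{n+1} > 0}. *)
Lemma maximal_inequality_fin n : (eps%:E * mu (A n) <= \int[mu]_w (g w)%:E)%E.
Proof.
case: n => [|n].
  rewrite (_ : A 0 = set0) ?measure0 ?mule0 ?integral_ge0//.
    by move=> w _; rewrite lee_fin.
  by apply/seteqP; split => w //=; rewrite /A/= ltxx.
have I1 : (\int[mu]_w (max_sums h n.+1 w)%:E + eps%:E * mu (A n.+1) <=
    \int[mu]_w (g w)%:E + \int[mu]_w (max_sums h n.+1 w)%:E)%E.
  rewrite -[X in (_ <= _ + X)%E](@ge0_integral_comp_invariant (fun w => (max_sums h n.+1 w)%:E))//; last first.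
    by move=> w; rewrite lee_fin max_sums_ge0.
  rewrite -(setIT (A n.+1)) -integral_indic//.
  have mI : measurable_fun setT (fun w => (\1_(A n.+1) w)%:E : \bar R).
    by apply/measurable_EFinP; exact: measurable_indic.
  have eps0' : 0 <= eps by exact: ltW.
  rewrite -ge0_integralZl_EFin//.
  rewrite -ge0_integralD//; last 3 first.
  - by move=> w _; rewrite lee_fin max_sums_ge0.
  - by move=> w _; rewrite mule_ge0// lee_fin ltW.
  - exact: measurable_funeM.
  rewrite -ge0_integralD//; last 2 first.
  - by move=> w _; rewrite lee_fin.
  - by move=> w _; rewrite lee_fin max_sums_ge0.
  apply: ge0_le_integral => //.
  - move=> w _; rewrite adde_ge0 ?lee_fin ?max_sums_ge0//.
    by rewrite mulr_ge0// ltW.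
  - by apply: emeasurable_funD => //; exact: measurable_funeM.
  - exact: emeasurable_funD.
  - move=> w _; rewrite -EFinM -!EFinD lee_fin indicE.
    have [wA|wA] := boolP (w \in A n.+1).
      move: wA; rewrite inE /A => wA; rewrite mulr1.
      (* Where the maximum is positive the 0 in the recursion is not attained, and monotonicity in
         [n] replaces the maximum of order [n] along [th w] by that of order [n.+1]. *)
      have := max_sums_le_succ h n (th w).
      have -> : max_sums h n.+1 w = h w + max_sums h n (th w).
        move: wA => /=; rewrite lt_max ltxx /= => /ltW H.
        by apply/max_idPr.
      have : h w = g w - eps by []; lra.
    rewrite mulr0 addr0.
    have -> : max_sums h n.+1 w = 0.
      apply/eqP; rewrite eq_le max_sums_ge0 andbT leNgt.
      by move: wA; rewrite notin_setE /A => /negP.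
    by rewrite addr_ge0// max_sums_ge0.
have fM : (\int[mu]_w (max_sums h n.+1 w)%:E)%E \is a fin_num.
  rewrite ge0_fin_numE ?integral_max_sums_lty ?integral_ge0// => w _.
  by rewrite lee_fin max_sums_ge0.
by move: I1; rewrite [leRHS]addeC leeD2lE.
Qed.

(** The sets [A n] increase with [n] and the bound for each does not depend on [n], so it passes to
    their union. *)
Lemma maximal_inequality : (mu [set w | exists n, (0 < max_sums h n w)%R] <=
  (eps^-1)%:E * \int[mu]_w (g w)%:E)%E /\
  measurable [set w | exists n, 0 < max_sums h n w].
Proof.
have -> : [set w | exists n, 0 < max_sums h n w] = \bigcup_n A n.
  by apply/seteqP; split => w [n]; [exists n|exists n].
have mU : measurable (\bigcup_n A n) by exact: bigcupT_measurable.
split => //.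
have ndA : nondecreasing_seq A.
  apply/nondecreasing_seqP => n; apply/subsetPset => w; rewrite /A/=.
  by move=> /lt_le_trans; apply; exact: max_sums_le_succ.
have cv := @nondecreasing_cvg_mu _ _ _ mu _ mA mU ndA.
rewrite -(cvg_lim _ cv)//; apply: lime_le; first by apply/cvg_ex; eexists; exact: cv.
apply: nearW => n /=; have := maximal_inequality_fin n.
rewrite -(@lee_pmul2l _ (eps^-1)%:E)//; last by rewrite lte_fin invr_gt0.
by rewrite muleA -EFinM mulVf ?gt_eqF// mul1e.
Qed.

End MaximalErgodic.

Section SublinearGrowth.
Context d (T : measurableType d) (R : realType) (mu : probability T R).
Variables (th : T -> T) (mth : measurable_fun setT th).
Hypothesis th_inv : forall B, measurable B -> mu (th @^-1` B) = mu B.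
Variables (f g : T -> R) (eps : R).
Hypotheses (mf : measurable_fun setT f) (mg : measurable_fun setT g).
Hypotheses (g0 : forall w, 0 <= g w).
Hypotheses (ig : (\int[mu]_w (g w)%:E < +oo)%E) (eps0 : 0 < eps).

(** The part of the increment bound that matters when only values of [f] above level [M] are
    tracked. Its integral tends to 0 as [M] grows, by dominated convergence, since [f] is finite
    everywhere. *)
Let gM (M : nat) w := if M%:R < f (th w) then g w else 0.

Let mgM M : measurable_fun setT (gM M).
Proof.
apply: measurable_fun_ifT => //.
apply: measurable_fun_ltr; first exact: measurable_cst.
exact: (measurableT_comp mf mth).
Qed.

Let gM0 M w : 0 <= gM M w.
Proof. by rewrite /gM; case: ifP. Qed.

Let gM_le M w : gM M w <= g w.
Proof. by rewrite /gM; case: ifP. Qed.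

Let mgME M : measurable_fun setT (fun w => (gM M w)%:E).
Proof. exact/measurable_EFinP. Qed.

Let igM M : (\int[mu]_w (gM M w)%:E < +oo)%E.
Proof.
apply: le_lt_trans ig; apply: ge0_le_integral => //.
- by move=> w _; rewrite lee_fin.
- exact/measurable_EFinP.
- by move=> w _; rewrite lee_fin.
Qed.

Let cvg_gM : (\int[mu]_w (gM M w)%:E @[M --> \oo] --> 0)%E.
Proof.
have -> : (0 = \int[mu]_(x in setT) (cst 0 x) :> \bar R)%E by rewrite integral0.
apply: (@dominated_cvg _ _ _ mu setT measurableT (fun M w => (gM M w)%:E)
  (cst 0%E) (fun w => (g w)%:E)) => //.
- move=> w _; apply: cvg_near_cst; near=> M.
  rewrite /gM; rewrite ltNge (_ : f (th w) <= _)//.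
  near: M; exact: nbhs_infty_ger.
- apply/integrableP; split; first exact/measurable_EFinP.
  by under eq_integral do rewrite /= ger0_norm//.
- by move=> M w _; rewrite /= lee_fin ger0_norm.
Unshelve. all: by end_near. Qed.

(** For a path outside [Bad M] every Birkhoff sum of [gM M] is at most [n%:R * eps], and these sums
    control the growth of [f] truncated below at [M]. The exceptional paths lie in all [Bad M],
    whose measures tend to 0 by the maximal inequality. *)
Lemma sublinear_growth : \forall w \ae mu,
  (forall n, f (iter n.+1 th w) <= f (iter n th w) + g (iter n th w)) ->
  exists C, forall n, f (iter n th w) <= C + n%:R * eps.
Proof.
pose Bad M := [set w | exists n, 0 < max_sums th (fun w => gM M w - eps) n w].
have mB M : (mu (Bad M) <= (eps^-1)%:E * \int[mu]_w (gM M w)%:E)%E /\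
    measurable (Bad M) by exact: maximal_inequality.
have mN : measurable (\bigcap_M Bad M).
  by apply: bigcapT_measurable => M; exact: (mB M).2.
exists (\bigcap_M Bad M); split => //.
  apply/eqP; rewrite eq_le measure_ge0 andbT.
  have cv : ((eps^-1)%:E * \int[mu]_w (gM M w)%:E @[M --> \oo] --> 0)%E.
    by rewrite -(mule0 (eps^-1)%:E); apply: cvgeZl.
  rewrite -(cvg_lim _ cv)//; apply: lime_ge; first by apply/cvg_ex; eexists; exact: cv.
  apply: nearW => M; apply: le_trans (mB M).1; apply: le_measure.
  - by rewrite inE.
  - by rewrite inE; exact: (mB M).2.
  - exact: bigcap_inf.
move=> w; apply: contra_notP => nB step.
have [M Mw] : exists M, ~ Bad M w.
  by apply/existsNP => allB; apply: nB => M _; exact: allB.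
(* Truncating at [M] makes the increment nonpositive whenever the next value of [f] is at most [M];
   otherwise [gM M] equals [g] and bounds it. *)
pose phi v := Num.max (f v) M%:R.
have phi_step n : phi (iter n.+1 th w) <= phi (iter n th w) + gM M (iter n th w).
  rewrite [leLHS]/phi ge_max; apply/andP; split.
    rewrite /gM -[th (iter n th w)]/(iter n.+1 th w); case: ifPn => [_|].
      by apply: le_trans (step n) _; rewrite lerD2r /phi le_max lexx.
    by rewrite -leNgt addr0 => /le_trans; apply; rewrite /phi le_max lexx orbT.
  by apply: (@le_trans _ _ (phi (iter n th w)));
    [rewrite /phi le_max lexx orbT|rewrite lerDl].
have phi_sum n : phi (iter n th w) <= phi w + \sum_(k < n) gM M (iter k th w).
  elim: n => [|n IH]; first by rewrite big_ord0 addr0.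
  by rewrite big_ord_recr /= addrA; apply: le_trans (phi_step n) _; rewrite lerD2r.
exists (phi w) => n; apply: (@le_trans _ _ (phi (iter n th w))).
  by rewrite /phi le_max lexx.
apply: le_trans (phi_sum n) _; rewrite lerD2l.
have : \sum_(k < n) (gM M (iter k th w) - eps) <= 0.
  apply: le_trans (sums_le_max_sums th (fun w => gM M w - eps) n w) _.
  by rewrite leNgt; apply/negP => H; apply: Mw; exists n.
by rewrite sumrB sumr_const card_ord subr_le0 mulr_natl.
Qed.

End SublinearGrowth.

(** * Groups with a dichotomy and mild solutions *)

Section Group.
Context {R : realType} {H : completeNormedModType R}.
Variables (S : R -> {linear H -> H}).
Hypothesis hS : strongly_continuous_group S.

Let cS t : continuous (S t). Proof. by case: hS. Qed.
Let S0 x : S 0 x = x. Proof. by case: hS. Qed.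
Let SD s t x : S (s + t) x = S s (S t x). Proof. by case: hS. Qed.
Let scS x : continuous (fun t => S t x). Proof. by case: hS. Qed.

(** The dichotomy bounds the [P] part for negative times and the [Q] part for positive times. The
    missing direction is reached by factoring out the bounded operator [S 1] or [S (-1)]. *)
Lemma dichotomy_group_bound (P : {linear H -> H}) (alpha beta K : R) :
  exponential_dichotomy S P alpha beta K ->
  exists2 C : R, 1 <= C & forall t x, `|t| <= 1 -> `|S t x| <= C * `|x|.
Proof.
move=> [[ba a0 K0] _ PS _ [bP bQ]].
have [C1 C10 C1P] := continuous_linear_boundP (@cS 1).
have [C2 C20 C2P] := continuous_linear_boundP (@cS (-1)).
have b0 : beta < 0 by exact: lt_trans a0.
pose cP := K * expR (- alpha) * (1 + C1); pose cQ := K * expR (- beta) * (1 + C2).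
have Kx (a t : R) y c x : 0 <= c -> a < 0 -> `|t| <= 1 -> `|y| <= (1 + c) * `|x| ->
    K * expR (a * t) * `|y| <= K * expR (- a) * (1 + c) * `|x|.
  move=> c0 an t1 yx; rewrite -(mulrA (K * _)); apply: ler_pM => //.
  - by rewrite mulr_ge0 ?expR_ge0// ltW.
  - rewrite ler_pM2l// ler_expR -mulrN1 ler_nM2l//.
    by move: t1; rewrite ler_norml => /andP[].
(* For [0 < t <= 1], [S t (P x)] is rewritten as [S (t - 1) (P (S 1 x))], whose time is
   nonpositive. *)
have hP t x : `|t| <= 1 -> `|S t (P x)| <= cP * `|x|.
  move=> t1; have [t0|t0] := leP t 0.
    apply: le_trans (bP _ _ t0) _; apply: Kx => //; first exact: ltW.
    by rewrite ler_peMl// lerDl ltW.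
  have t1' : `|t - 1| <= 1.
    by move: t1; rewrite !ler_norml => /andP[]; lra.
  rewrite -(subrK 1 t) SD -PS; apply: le_trans (bP _ _ _) _.
    by move: t1; rewrite ler_norml => /andP[]; lra.
  apply: Kx => //; first exact: ltW.
  by apply: le_trans (C1P _) _; rewrite ler_wpM2r// ler_wpDl.
have hQ t x : `|t| <= 1 -> `|S t (x - P x)| <= cQ * `|x|.
  move=> t1; have [t0|t0] := leP 0 t.
    apply: le_trans (bQ _ _ t0) _; apply: Kx => //; first exact: ltW.
    by rewrite ler_peMl// lerDl ltW.
  have t1' : `|t + 1| <= 1.
    by move: t1; rewrite !ler_norml => /andP[]; lra.
  rewrite -[t](addrK 1 t) SD linearB /= -PS; apply: le_trans (bQ _ _ _) _.
    by move: t1; rewrite ler_norml => /andP[]; lra.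
  apply: Kx => //; first exact: ltW.
  by apply: le_trans (C2P _) _; rewrite ler_wpM2r// ler_wpDl.
exists (1 + (cP + cQ)).
  by rewrite lerDl addr_ge0// !mulr_ge0 ?expR_ge0 ?ltW// addr_gt0.
move=> t x t1; rewrite -[in leLHS](subrK (P x) x) linearD.
apply: le_trans (ler_normD _ _) _; apply: le_trans (lerD (hQ _ _ t1) (hP _ _ t1)) _.
by rewrite -mulrDl ler_wpM2r// addrC lerDr.
Qed.

Hypothesis bS : exists2 C : R, 1 <= C &
  forall t x, `|t| <= 1 -> `|S t x| <= C * `|x|.

(** Joint continuity in time and vector. After factoring out [S a0], the local bound handles the
    term with [y r - y0] and strong continuity handles the term with [y0] fixed. *)
Lemma group_cvg (T : Type) (F : set_system T) (a : T -> R) (y : T -> H) a0 y0 :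
  Filter F -> a @ F --> a0 -> y @ F --> y0 ->
  S (a r) (y r) @[r --> F] --> S a0 y0.
Proof.
move=> FF aa0 yy0; have [C C1 SC] := bS.
suff H1 : S (a r - a0) (y r) @[r --> F] --> y0.
  have := @cvg_comp _ _ _ _ (S a0) F _ _ H1 (@cS a0 y0).
  by apply: cvg_trans; apply: near_eq_cvg; near=> r; rewrite /= -SD [a0 + _]addrC subrK.
have d0 : (a r - a0) @[r --> F] --> 0.
  by rewrite -(subrr a0); apply: cvgB => //; exact: cvg_cst.
rewrite -[y0]add0r (_ : (fun r => _) = fun r =>
  S (a r - a0) (y r - y0) + S (a r - a0) y0); last first.
  by apply/funext => r; rewrite -linearD subrK.
apply: cvgD; last first.
  rewrite -[X in _ --> X]S0.
  exact: (@cvg_comp _ _ _ _ (fun t => S t y0) F _ _ d0 (@scS y0 0)).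
apply/norm_cvg0P; apply: (@squeeze_cvgr _ _ _ _ (fun=> 0) (fun r => C * `|y r - y0|)).
- near=> r; rewrite normr_ge0 SC//.
  by near: r; apply: cvgr0_norm_le.
- exact: cvg_cst.
- rewrite -(mulr0 C); apply: cvgMr; rewrite -(@normr0 _ H).
  apply: cvg_norm; rewrite -(subrr y0); apply: cvgB => //; exact: cvg_cst.
Unshelve. all: by end_near. Qed.

Lemma group_within_continuous (D : set R) (a : R -> R) (y : R -> H) :
  {within D, continuous a} -> {within D, continuous y} ->
  {within D, continuous (fun r => S (a r) (y r))}.
Proof. by move=> ca cy x; apply: group_cvg; [exact: ca|exact: cy]. Qed.

Lemma group_continuous (a : R -> R) (y : R -> H) :
  continuous a -> continuous y -> continuous (fun r => S (a r) (y r)).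
Proof. by move=> ca cy x; apply: group_cvg; [exact: ca|exact: cy]. Qed.

End Group.

Section Mild.
Context {R : realType} {H : completeNormedModType R}.
Variables (S : R -> {linear H -> H}).
Hypothesis hS : strongly_continuous_group S.
Hypothesis bS : exists2 C : R, 1 <= C &
  forall t x, `|t| <= 1 -> `|S t x| <= C * `|x|.

(* d(t) = S (t - s) d(s) + \int_s^t S (t - r) g(r) dr, multiplied by S (- t) *)
Definition mild (d g : R -> H) := forall s t, s <= t ->
  is_integral `[s, t] (fun r => S (- r) (g r)) (S (- t) (d t) - S (- s) (d s)).

Lemma mild_continuous_integrand (g : R -> H) : continuous g ->
  continuous (fun r => S (- r) (g r)).
Proof. by move=> cg; apply: group_continuous => //; exact: opp_continuous. Qed.

(** Applying [S tau] to the defining identity recovers the variation of constants formula; [tau = t]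
    reads it forward in time and [tau = s] backward. *)
Lemma mild_at (d g : R -> H) tau s t : continuous g -> mild d g -> s <= t ->
  is_integral `[s, t] (fun r => S (tau - r) (g r))
    (S (tau - t) (d t) - S (tau - s) (d s)).
Proof.
move=> cg md st; have SD u v x : S (u + v) x = S u (S v x) by case: hS.
have cS u : continuous (S u) by case: hS.
apply: (@eq_is_integral _ _ _ (fun r => S tau (S (- r) (g r)))) => [//|r _|].
  by rewrite SD.
rewrite !SD -linearB; apply: is_integral_linear.
- exact: measurable_itv.
- exact: cS.
- by apply: continuous_subspaceT; exact: mild_continuous_integrand.
- exact: md.
Qed.

Lemma continuous_norm_integrable (f : R -> H) a b : continuous f ->
  lebesgue_measure.-integrable `[a, b] (fun s => `|f s|%:E).
Proof.
move=> cf; apply: (@continuous_compact_integrable R (fun s => `|f s|)).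
  exact: segment_compact.
by apply: continuous_subspaceT => x; apply: continuous_comp; [exact: cf|exact: norm_continuous].
Qed.

Lemma eq_on_rat (a b : R) (f : R -> R) : a < b ->
  {within `[a, b], continuous f} ->
  (forall q : rat, ratr q \in `]a, b[ -> f (ratr q) = 0) ->
  forall x, x \in `]a, b[ -> f x = 0.
Proof.
move=> ab /(continuous_within_itvP _ ab)[cf _ _] f0 x xab.
apply/eqP; apply: contraT => fx0.
have : \forall y \near x, f y != 0 /\ y \in `]a, b[.
  near=> y; split; last by near: y; exact: near_in_itvoo.
  near: y; apply: (cf x xab (fun y => y != 0)).
  by apply: open_nbhs_nbhs; split => //; exact: open_neq.
move=> /nbhs_ballP[e /= e0 eB].
have [y [By [q _ qy]]] : ball x e `&` (@ratr R @` setT) !=set0.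
  by apply: dense_rat; [exists x; exact: ballxx|exact: ball_open].
have [] := eB y By; rewrite -qy => + qab.
by rewrite (f0 _ qab) eqxx.
Unshelve. all: by end_near. Qed.

(** An almost sure identity can be secured for countably many pairs of times only. Once tested with
    a functional, both sides are continuous in the time variable, so rational times determine all
    others. *)
Lemma mild_of_rat (d g : R -> H) : continuous d -> continuous g ->
  (forall p q : rat, ratr p <= ratr q :> R ->
    is_integral `[ratr p, ratr q : R] (fun r => S (- r) (g r))
      (S (- ratr q) (d (ratr q)) - S (- ratr p) (d (ratr p)))) ->
  mild d g.
Proof.
move=> cd cg mq s t st; have ck := mild_continuous_integrand cg.
apply: is_integral_intro => //.
- exact: continuous_subspaceT.
- exact: continuous_norm_integrable.
move=> phi cphi; pose k r : R := phi (S (- r) (g r)).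
pose E r : R := phi (S (- r) (d r)).
have ckk : continuous k.
  move=> x; apply: (@continuous_comp _ _ _ (fun r => S (- r) (g r)) phi).
    exact: ck.
  exact: cphi.
have cE : continuous E.
  move=> x; apply: (@continuous_comp _ _ _ (fun r => S (- r) (d r)) phi); last exact: cphi.
  by apply: group_continuous => //; exact: opp_continuous.
have ik (a b : R) : lebesgue_measure.-integrable `[a, b] (EFin \o k).
  apply: (@continuous_compact_integrable R k); first exact: segment_compact.
  exact: continuous_subspaceT.
(* Integrals are based at a rational point [a] left of [s], and [b] lies right of [t], so that [s]
   and [t] are interior points of [[a, b]]. *)
have [qa /itvP qas] : exists q : rat, ratr q \in `]s - 1, s[.
  by apply: rat_in_itvoo; rewrite gtrBl.
pose a : R := ratr qa; have as_ : a < s by rewrite qas.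
pose b := t + 1; have tb : t < b by rewrite ltrDl.
have ab : a < b by apply: lt_trans as_ _; exact: le_lt_trans tb.
pose G x := \int[lebesgue_measure]_(r in `[a, x]) k r.
have GE (x y : R) : a <= x -> x <= y ->
    (G y - G x)%:E = (\int[lebesgue_measure]_(r in `[x, y]) (k r)%:E)%E.
  move=> ax xy; rewrite /G (@Rintegral_itvB R k (BLeft a) (BRight y) x)//.
  rewrite Rintegral_itv_obnd_cbnd; last first.
    by apply: integrableS (ik x y) => //; apply: subset_itvr; rewrite bnd_simp.
  rewrite /Rintegral fineK//; exact: integrable_fin_num.
have EG x : x \in `]a, b[ -> E x - E a - G x = 0.
  move: x; apply: (@eq_on_rat a b (fun x => E x - E a - G x)) => //.
    move=> z; apply: cvgB; last first.
      exact: (parameterized_integral_continuous (ltW ab) (ik a b)).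
    apply: cvgB; last exact: cvg_cst.
    by apply: continuous_subspaceT.
  move=> q /itvP qab; have aq : a <= ratr q by rewrite ltW// qab.
  have [_ /(_ phi cphi)[_]] := mq qa q aq.
  rewrite linearB /= => /eqP; rewrite -/(E _) -/(E _) -(GE a (ratr q))//.
  rewrite eqe => /eqP ->; rewrite {2}/G set_itv1 Rintegral_set1; ring.
have sab : s \in `]a, b[ by rewrite in_itv /= as_ (le_lt_trans st).
have tab : t \in `]a, b[ by rewrite in_itv /= tb andbT (lt_le_trans as_).
have Ets : E t - E s = G t - G s by have := EG _ sab; have := EG _ tab; lra.
by have := GE s t (ltW as_) st; rewrite -Ets => <-; rewrite linearB.
Qed.

End Mild.

(** * A priori bound for mild solutions over a short step backward in time *)

Section APriori.
Context {R : realType} {H : completeNormedModType R}.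
Variable ip : {dot H for @idfun R}.
Hypothesis hH : hilbert ip.
Variables (S : R -> {linear H -> H}).
Hypothesis hS : strongly_continuous_group S.
Variables (C : R).
Hypothesis C1 : 1 <= C.
Hypothesis SC : forall t x, `|t| <= 1 -> `|S t x| <= C * `|x|.
Variables (F : H -> H) (L : R).
Hypothesis L0 : 0 <= L.
Hypothesis FL : forall x y, `|F x - F y| <= L * `|x - y|.

Lemma lipschitz_growth x : `|F x| <= `|F 0| + L * `|x|.
Proof.
rewrite -{1}[F x](subrK (F 0)) addrC; apply: le_trans (ler_normD _ _) _.
by rewrite lerD2l -{2}[x]subr0.
Qed.

(** A Gronwall-type estimate without iteration: the maximum [M] of the norm of [d] on the step
    reappears on the right with factor [C * L * h], at most one half, and is absorbed on the
    left. *)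
Lemma mild_step (d z : R -> H) (h t : R) :
  continuous d -> continuous z -> continuous F ->
  mild S d (fun r => F (d r + z r)) ->
  0 < h -> h <= 1 -> C * L * h <= 2^-1 ->
  forall s, t - h <= s -> s <= t ->
  `|d s| <= 2 * C * (`|d t| + `|F 0| +
    L * \int[lebesgue_measure]_(r in `[t - h, t]) `|z r|).
Proof.
move=> cd cz cF md h0 h1 CLh.
have C0 : 0 < C by exact: lt_le_trans C1.
have bS : exists2 C : R, 1 <= C &
  forall t x, `|t| <= 1 -> `|S t x| <= C * `|x| by exists C.
set I := \int[lebesgue_measure]_(r in `[t - h, t]) `|z r|.
have tht : t - h <= t by rewrite gerBl ltW.
have cnd : continuous (fun r => `|d r|).
  by move=> x; apply: continuous_comp; [exact: cd|exact: norm_continuous].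
have cg : continuous (fun r => F (d r + z r)).
  move=> x; apply: (@continuous_comp _ _ _ (fun r => d r + z r) F); last exact: cF.
  by apply: cvgD; [exact: cd|exact: cz].
have [c cin cmax] := EVT_max tht (continuous_subspaceT cnd).
set M := `|d c| in cmax.
have bound s : t - h <= s -> s <= t ->
    `|d s| <= C * `|d t| + (C * (`|F 0| + L * M) * h + C * L * I).
  move=> hs st; have S0 x : S 0 x = x by case: hS.
  (* The group property lets the equation be solved backward: [d s] is [S (s - t) (d t)] minus the
     integral of [S (s - r)] applied to the forcing. *)
  have := mild_at hS bS s cg md st; rewrite subrr S0.
  set v := _ - d s => vint.
  have -> : d s = S (s - t) (d t) - v by rewrite /v opprB addrC subrK.
  apply: le_trans (ler_normB _ _) _; apply: lerD.
    by apply: SC; rewrite ler_norml; apply/andP; split; lra.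
  have izz : lebesgue_measure.-integrable `[t - h, t] (fun s => `|z s|%:E).
    exact: continuous_norm_integrable.
  have mu_th : lebesgue_measure (`[t - h, t]%classic : set R) = h%:E.
    rewrite lebesgue_measure_itv /= lte_fin ltrBlDr ltrDl h0.
    by rewrite -EFinB; congr EFin; ring.
  have icst : lebesgue_measure.-integrable `[t - h, t]
      (EFin \o (fun=> C * (`|F 0| + L * M) : R)).
    apply: (@continuous_compact_integrable R (fun=> _)); first exact: segment_compact.
    by apply: continuous_subspaceT => x; exact: cvg_cst.
  pose b r := C * (`|F 0| + L * M) + C * L * `|z r|.
  have iclz : lebesgue_measure.-integrable `[t - h, t]
      (EFin \o (fun r => C * L * `|z r|)).
    exact: (@integrableZl _ _ R lebesgue_measure `[t - h, t] _ (C * L) _ izz).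
  have ib : lebesgue_measure.-integrable `[t - h, t] (EFin \o b).
    exact: (@integrableD _ _ R lebesgue_measure `[t - h, t] _ _ _ icst iclz).
  have Ib : \int[lebesgue_measure]_(r in `[t - h, t]) b r =
      C * (`|F 0| + L * M) * h + C * L * I.
    rewrite /b RintegralD//; congr (_ + _); last exact: RintegralZl.
    rewrite Rintegral_cst//; congr (_ * _); rewrite -[RHS]/(fine h%:E) -mu_th.
    by [].
  rewrite -Ib -lee_fin; apply: le_trans (is_integral_norm hH _ vint) _ => //.
  rewrite /Rintegral fineK; last exact: integrable_fin_num.
  have sub : `[s, t] `<=` `[t - h, t].
    by move=> r; rewrite /= !in_itv /= => /andP[sr ->]; rewrite (le_trans hs).
  have b0 r : 0 <= b r.
    have C0' := ltW C0; have M0 : 0 <= M by exact: normr_ge0.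
    have LM0 := mulr_ge0 L0 M0; have FM0 := addr_ge0 (normr_ge0 (F 0)) LM0.
    by rewrite /b; apply: addr_ge0; rewrite ?mulr_ge0.
  have mb : measurable_fun `[t - h, t] (EFin \o b) by have /integrableP[] := ib.
  apply: (@le_trans _ _ (\int[lebesgue_measure]_(r in `[s, t]) (b r)%:E)%E).
    apply: ge0_le_integral => //.
    - by case: vint => /integrableP[].
    - exact: measurable_funS mb.
    move=> r /=; rewrite in_itv /= => /andP[sr rt]; rewrite lee_fin.
    apply: le_trans (SC _ _) _; first by rewrite ler_norml; apply/andP; split; lra.
    rewrite /b -mulrA -mulrDr ler_pM2l//; apply: le_trans (lipschitz_growth _) _.
    rewrite -addrA lerD2l -mulrDr; apply: ler_wpM2l => //.
    apply: le_trans (ler_normD _ _) _; rewrite lerD2r; apply: cmax.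
    by rewrite in_itv /= rt andbT; lra.
  by apply: ge0_subset_integral => // r _; rewrite lee_fin; exact: b0.
have I0 : 0 <= I by apply: Rintegral_ge0.
have M_le : M <= 2 * (C * `|d t| + C * `|F 0| * h + C * L * I).
  have : t - h <= c <= t by move: cin; rewrite in_itv.
  move=> /andP[hc ct]; have := bound _ hc ct; rewrite -/M => bM.
  have M0 : 0 <= M by exact: normr_ge0.
  have : C * L * h * M <= 2^-1 * M by exact: ler_wpM2r.
  have : C * (`|F 0| + L * M) * h = C * `|F 0| * h + C * L * h * M by ring.
  move: bM; lra.
move=> s hs st; apply: le_trans (cmax _ _) _; first by rewrite in_itv /= hs.
apply: le_trans M_le _.
have F0h : C * `|F 0| * h <= C * `|F 0| by rewrite ler_piMr// mulr_ge0// ltW.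
have -> : 2 * C * (`|d t| + `|F 0| + L * I) =
  2 * (C * `|d t| + C * `|F 0| + C * L * I) by ring.
move: F0h; lra.
Qed.

End APriori.

(** * Lyapunov-Perron equations *)

Section LyapunovPerron.
Context {R : realType} {H : completeNormedModType R}.
Variable ip : {dot H for @idfun R}.
Hypothesis hH : hilbert ip.
Variables (S : R -> {linear H -> H}) (P : {linear H -> H}).
Variables (alpha beta K eta : R).
Hypothesis hS : strongly_continuous_group S.
Hypothesis hd : exponential_dichotomy S P alpha beta K.

Let bS := dichotomy_group_bound hS hd.
Let S0 x : S 0 x = x. Proof. by case: hS. Qed.
Let cP : continuous P. Proof. by case: hd => _ []. Qed.
Let PP x : P (P x) = P x. Proof. by case: hd => _ []. Qed.
Let PS t x : P (S t x) = S t (P x). Proof. by case: hd. Qed.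

(** At time 0 the first integral runs over a single point, and [P] annihilates the integrand of the
    second, so only [x0] survives. *)
Lemma lyapunov_perron_proj x0 G U : lyapunov_perron S P eta x0 G U ->
  P x0 = x0 -> P (U 0) = x0.
Proof.
move=> [_ /(_ 0 (lexx 0))[v1 [v2 [I1 I2 ->]]]] Px0.
have -> : v1 = 0.
  by move: I1; rewrite /is_oriented_integral lexx => /(is_integral_set1 hH).
rewrite S0 addr0 linearD /= Px0 -[RHS]addr0; congr (_ + _).
apply: (weak_separation hH) => phi cphi; rewrite linear0.
have cphiP : continuous (phi \o P : {linear H -> R^o}).
  move=> x; apply: (@continuous_comp _ _ _ P phi); first exact: cP.
  exact: cphi.
have [_ /(_ _ cphiP)[_ /= vE]] := I2.
move: vE; under eq_integral do rewrite PS linearB /= PP subrr !linear0.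
by rewrite integral0 => -[].
Qed.

Lemma Cminus_lincomb (c : R) (U V : R -> H) : Cminus eta U -> Cminus eta V ->
  Cminus eta (fun s => U s + c *: V s).
Proof.
move=> [cU [B UB]] [cV [B' VB]]; split.
  move=> x; apply: cvgD; first exact: cU.
  by apply: cvgZr; exact: cV.
exists (B + `|c| * B') => t t0.
apply: le_trans (_ : expR (- (eta * t)) * (`|U t| + `|c| * `|V t|) <= _).
  by rewrite ler_wpM2l ?expR_ge0// -normrZ ler_normD.
rewrite mulrDr mulrCA; apply: lerD; first exact: UB.
by rewrite ler_wpM2l//; exact: VB.
Qed.

(** The forcings may be nonlinear: they have to combine correctly only along the given pair of
    solutions and only for nonpositive times. *)
Lemma lyapunov_perron_lincomb (c : R) x0 x1 G0 G1 G2 U0 U1 :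
  lyapunov_perron S P eta x0 G0 U0 -> lyapunov_perron S P eta x1 G1 U1 ->
  (forall s, s <= 0 ->
    G2 s (U0 s + c *: U1 s) = G0 s (U0 s) + c *: G1 s (U1 s)) ->
  {within `]-oo, 0], continuous (fun s => G2 s (U0 s + c *: U1 s))} ->
  lyapunov_perron S P eta (x0 + c *: x1) G2 (fun s => U0 s + c *: U1 s).
Proof.
move=> [C0 E0] [C1 E1] GE cG; split; first exact: Cminus_lincomb.
move=> t t0; have [v1 [v2 [I1 I2 U0E]]] := E0 _ t0.
have [w1 [w2 [J1 J2 U1E]]] := E1 _ t0.
pose g s := G2 s (U0 s + c *: U1 s).
have cgP : {within `]-oo, 0], continuous (fun s => S (t - s) (P (g s)))}.
  apply: (group_within_continuous hS bS).
    by apply: continuous_subspaceT => x; apply: cvgB; [exact: cvg_cst|exact: cvg_id].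
  exact: within_continuous_postcomp.
have cgQ : {within `]-oo, 0], continuous (fun s => S (t - s) (g s - P (g s)))}.
  apply: (group_within_continuous hS bS).
    by apply: continuous_subspaceT => x; apply: cvgB; [exact: cvg_cst|exact: cvg_id].
  move=> x; apply: cvgB; first exact: cG.
  exact: (@within_continuous_postcomp _ _ _ _ g P cP cG x).
have PE s : s <= 0 -> S (t - s) (P (G0 s (U0 s))) +
    c *: S (t - s) (P (G1 s (U1 s))) = S (t - s) (P (g s)).
  by move=> s0; rewrite /g GE// (linearD P) (linearD (S (t - s))) !linearZZ.
have QE s : s <= 0 -> S (t - s) (G0 s (U0 s) - P (G0 s (U0 s))) +
    c *: S (t - s) (G1 s (U1 s) - P (G1 s (U1 s))) = S (t - s) (g s - P (g s)).
  move=> s0; rewrite /g GE// -linearZZ -linearD; congr (S _ _).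
  by rewrite (linearD P) linearZZ /= scalerBr opprD addrACA.
have lin (D : set R) (f0 f1 f2 : R -> H) (v w : H) : measurable D -> D `<=` `]-oo, 0] ->
    {within `]-oo, 0], continuous f2} ->
    (forall s, s <= 0 -> f0 s + c *: f1 s = f2 s) ->
    is_integral D f0 v -> is_integral D f1 w -> is_integral D f2 (v + c *: w).
  move=> mD D0 cf2 fE If0 If1.
  have D_le s : D s -> s <= 0 by move=> /D0; rewrite /= in_itv.
  apply: (@eq_is_integral _ _ D (fun s => f0 s + c *: f1 s)) => //.
    by move=> s /D_le; exact: fE.
  apply: is_integral_lincomb => //.
  apply: (@subspace_eq_continuous _ D _ f2).
    by move=> r; rewrite inE => /D_le r0; exact/esym/fE.
  exact: continuous_subspaceW cf2.
exists (v1 + c *: w1), (v2 + c *: w2); split.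
- move: I1 J1; rewrite /is_oriented_integral; case: ifP => [t0'|_].
    apply: lin PE => //.
    move=> s; rewrite /= !in_itv /= => /andP[_ st]; exact: le_trans st t0.
  move=> I1 J1; rewrite opprD -scalerN; apply: lin I1 J1 => //.
  by move=> s; rewrite /= !in_itv /= => /andP[].
- apply: lin QE I2 J2 => //.
  by move=> s; rewrite /= !in_itv /= => st; exact: le_trans st t0.
by rewrite U0E U1E !scalerDr (linearD (S t)) linearZZ /= addrACA [X in X + _]addrACA.
Qed.

End LyapunovPerron.

(** Dominated convergence for the integrands cut off outside [[t - n, t]], with the absolute value
    of [f] as majorant. *)
Lemma integral_cvg_itvNy (R : realType) (t : R) (f : R -> R) :
  lebesgue_measure.-integrable `]-oo, t] (EFin \o f) ->
  (\int[lebesgue_measure]_(s in `[(t - n%:R)%R, t]) (f s)%:E @[n --> \oo] -->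
   \int[lebesgue_measure]_(s in `]-oo, t]) (f s)%:E)%E.
Proof.
move=> If; have mf : measurable_fun `]-oo, t] (EFin \o f) by case/integrableP: If.
pose fn (n : nat) := (fun s : R => (f s)%:E) \_ ([set` `[t - n%:R, t]%R]).
rewrite [X in X @ _](_ : _ = fun n =>
    (\int[lebesgue_measure]_(s in [set` `]-oo, t]%R]) fn n s)%E); last first.
  apply/funext => n; rewrite /fn -integral_mkcondr; congr (integral _ _ _).
  apply/seteqP; split => s /=; rewrite !in_itv /=.
    by move=> /andP[ts st]; split => //; apply/andP.
  by move=> [].
apply: (@dominated_cvg _ _ R lebesgue_measure `]-oo, t] _ fn _
  (fun s => `|(f s)%:E|)%E).
- exact: measurable_itv.
- move=> n; apply/measurable_restrict => //.
  by apply: measurable_funS mf => // s [].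
- move=> s; rewrite /= in_itv /= => st; apply: cvg_near_cst; near=> n.
  rewrite /fn patchE mem_set//= in_itv /= st andbT lerBlDr -lerBlDl.
  by near: n; exact: nbhs_infty_ger.
- by [].
- exact: integrable_abse.
- by move=> n s _; rewrite /fn patchE; case: ifP => // _; rewrite abse0.
Unshelve. all: by end_near. Qed.

(** * From mild solutions to Lyapunov-Perron solutions *)

Section MildLyapunovPerron.
Context {R : realType} {H : completeNormedModType R}.
Variables (S : R -> {linear H -> H}) (P : {linear H -> H}).
Variables (alpha beta K eta : R).
Hypothesis hS : strongly_continuous_group S.
Hypothesis hd : exponential_dichotomy S P alpha beta K.

Let bS := dichotomy_group_bound hS hd.
Let S0 x : S 0 x = x. Proof. by case: hS. Qed.
Let cP : continuous P. Proof. by case: hd => _ []. Qed.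
Let PS t x : P (S t x) = S t (P x). Proof. by case: hd. Qed.

Lemma dichotomy_decay (t : R) x : 0 <= t -> `|S t (x - P x)| <= K * expR (beta * t) * `|x|.
Proof. by case: hd => _ _ _ _ [_]; apply. Qed.

(** The [P] part is the projected mild equation between 0 and [t]. The [Q] part is the projected
    equation on [[t - n, t]] as [n] grows; the weight in the integrability hypothesis is the one
    produced by the decay of [S (t - s)] on the range of [Q]. *)
Lemma mild_lyapunov_perron (d g : R -> H) : continuous d -> continuous g ->
  mild S d g -> beta < eta ->
  (exists B, forall t, t <= 0 -> expR (- (eta * t)) * `|d t| <= B) ->
  lebesgue_measure.-integrable `]-oo, 0]
    (EFin \o (fun r => expR (- (beta * r)) * `|g r|)) ->
  lyapunov_perron S P eta (P (d 0)) (fun s _ => g s) d.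
Proof.
move=> cd cg md be [B dB] Ig; split.
  by split; [exact: continuous_subspaceT|exists B].
(* The witnesses are forced: the two projections of [d t], the first with the initial term
   removed. *)
move=> t t0; exists (P (d t) - P (S t (d 0))), (d t - P (d t)).
have cts : continuous (fun s => t - s).
  by move=> x; apply: cvgB; [exact: cvg_cst|exact: cvg_id].
have cSg : continuous (fun s => S (t - s) (g s)) by exact: group_continuous.
have K0 : 0 < K by case: hd => -[].
split; last by rewrite PS [X in X + _]addrC subrK addrC subrK.
- rewrite /is_oriented_integral; case: ifP => [t0'|_].
    have := mild_at hS bS t cg md t0'; rewrite subrr S0 subr0.
    move=> /(is_integral_linear (measurable_itv _) cP (continuous_subspaceT cSg)).
    rewrite linearB; apply: eq_is_integral => // s _; exact: PS.
  have := mild_at hS bS t cg md t0; rewrite subrr S0 subr0.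
  move=> /(is_integral_linear (measurable_itv _) cP (continuous_subspaceT cSg)).
  rewrite linearB opprB; apply: eq_is_integral => // s _; exact: PS.
pose Q : {linear H -> H} := idfun \- P.
have cQ : continuous Q by move=> x; apply: cvgB; [exact: cvg_id|exact: cP].
have QS r x : Q (S r x) = S r (Q x) by rewrite /= PS linearB.
have cf : continuous (fun s => S (t - s) (g s - P (g s))).
  apply: (group_continuous hS bS) => // x; apply: cvgB; first exact: cg.
  exact: (@continuous_comp _ _ _ g P x (cg x) (@cP (g x))).
pose f s := S (t - s) (g s - P (g s)).
have If : lebesgue_measure.-integrable `]-oo, t] (fun s => `|f s|%:E).
  pose b s := K * expR (beta * t) * (expR (- (beta * s)) * `|g s|).
  apply: (integrable_norm_le (b := b)) => //.
  - exact: continuous_subspaceT.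
  - apply: (@integrableZl _ _ R lebesgue_measure `]-oo, t] _ (K * expR (beta * t))
      (EFin \o (fun r => expR (- (beta * r)) * `|g r|))) => //.
    apply: integrableS Ig => //.
    by move=> s; rewrite /= !in_itv /= => st; exact: le_trans t0.
  - move=> s; rewrite /= in_itv /= => st; rewrite /f /b.
    apply: le_trans (dichotomy_decay _ _) _; first by rewrite subr_ge0.
    by rewrite mulrBr expRD !mulrA.
apply: is_integral_intro => //; first exact: continuous_subspaceT.
move=> phi cphi; pose k s : R := phi (f s).
have [Cp Cp0 Cphi] := continuous_linear_boundP cphi.
have Ik : lebesgue_measure.-integrable `]-oo, t] (EFin \o k).
  by apply: integrable_linear => //; exact: continuous_subspaceT.
have E n : ((phi (Q (d t)) - phi (S n%:R (Q (d (t - n%:R)))) : R)%:E =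
    \int[lebesgue_measure]_(s in `[(t - n%:R)%R, t]) (k s)%:E)%E.
  have tn : t - n%:R <= t by rewrite gerBl.
  have := mild_at hS bS t cg md tn; rewrite subrr S0 subKr.
  move=> /(is_integral_linear (measurable_itv _) cQ (continuous_subspaceT cSg)).
  rewrite linearB QS => -[_ /(_ phi cphi)[_]]; rewrite linearB => ->.
  by apply: eq_integral => s _; rewrite QS.
(* The boundary term decays geometrically: decay at rate [beta] over time [n] beats growth at rate
   [eta] of [d (t - n)], with ratio [expR (beta - eta) < 1]. *)
have cv0 : (phi (S n%:R (Q (d (t - n%:R)))) : R) @[n --> \oo] --> (0 : R).
  pose q := expR (beta - eta).
  have q1 : `|q| < 1 by rewrite ger0_norm ?expR_ge0// expR_lt1 subr_lt0.
  pose c := Cp * (K * (expR (eta * t) * B)).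
  apply/norm_cvg0P; apply: (@squeeze_cvgr _ _ _ _ (fun=> 0) (fun n => c * q ^+ n)).
  - apply: nearW => n; rewrite normr_ge0 /=.
    apply: le_trans (Cphi _) _; rewrite /c -!mulrA ler_pM2l//.
    apply: le_trans (dichotomy_decay _ (ler0n _ n)) _; rewrite -!mulrA ler_pM2l//.
    have tn0 : t - n%:R <= 0 by rewrite subr_le0 (le_trans t0).
    have := dB _ tn0; rewrite expRN ler_pdivrMl ?expR_gt0// => dn.
    apply: le_trans (_ : expR (beta * n%:R) * (expR (eta * (t - n%:R)) * B) <= _).
      by rewrite ler_pM2l ?expR_gt0.
    have -> : expR (eta * t) * (B * q ^+ n) =
        expR (eta * t + n%:R * (beta - eta)) * B.
      by rewrite expRD expRM_natl -/q; ring.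
    rewrite mulrA -expRD le_eqVlt; apply/orP; left; apply/eqP.
    by congr (expR _ * _); ring.
  - exact: cvg_cst.
  - by rewrite -(mulr0 c); apply: cvgMr; exact: cvg_expr.
have := integral_cvg_itvNy Ik; under eq_fun do rewrite -E.
move=> cvI; rewrite -[RHS](cvg_lim _ cvI)//; apply/esym/cvg_lim => //.
apply: cvg_EFin; first by apply: nearW.
rewrite -[X in _ --> X]subr0; apply: cvgB => //; exact: cvg_cst.
Qed.

End MildLyapunovPerron.

(** * Integrals along paths as limits of Riemann sums *)

Section RiemannSums.
Context {R : realType}.
Implicit Types (q : R -> R).

Lemma heine q (a b e : R) : continuous q -> 0 < e ->
  exists2 delta : R, 0 < delta & forall x y, x \in `[a, b] -> `|y - x| < delta ->
    `|q y - q x| < e.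
Proof.
move=> cq e0; pose Pr (delta x : R) := forall y, `|y - x| < delta -> `|q y - q x| < e.
have cover x : [set` `[a, b]] x -> \forall x' \near x & d \near (0 : R)^'+, Pr d x'.
  move=> _; have e20 : 0 < e / 2 by rewrite divr_gt0.
  have : \forall y \near x, `|q x - q y| < e / 2 by have := cq x; move=> /cvgrPdist_lt; apply.
  move=> /nbhs_ballP[r /= r0 rB]; have r20 : 0 < r / 2 by rewrite divr_gt0.
  near=> x' d => y /= yx'; have x'r : `|x - x'| < r / 2.
    by near: x'; exact: (nbhsx_ballx x _ r20).
  have dr : d < r / 2 by near: d; exact: nbhs_right_lt.
  have qx' : `|q x - q x'| < e / 2.
    by apply: rB; rewrite /ball /=; apply: lt_trans x'r _; rewrite ltr_pdivrMr// ltr_pMr// ltr1n.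
  have qy : `|q x - q y| < e / 2.
    apply: rB; rewrite /ball /= (splitr r).
    by apply: le_lt_trans (ler_distD x' _ _) _; rewrite ltrD// distrC; exact: lt_trans dr.
  rewrite (splitr e); apply: le_lt_trans (ler_distD (q x) _ _) _.
  by rewrite ltrD// distrC.
have /compact_near_coveringP/(_ R (0 : R)^'+ Pr _ cover) rP := @segment_compact R a b.
near (0 : R)^'+ => d; exists d; first by near: d; exact: nbhs_right_gt.
have dP : [set` `[a, b]] `<=` Pr d by near: d.
by move=> x y xab; apply: dP.
Unshelve. all: by end_near. Qed.

Lemma integrable_continuous q (a b : R) : continuous q ->
  lebesgue_measure.-integrable `[a, b] (EFin \o q).
Proof.
move=> cq; apply: (@continuous_compact_integrable R q); first exact: segment_compact.
exact: continuous_subspaceT.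
Qed.

Lemma Rintegral_split q (a b c : R) : continuous q -> a <= b -> b <= c ->
  \int[lebesgue_measure]_(r in `[a, c]) q r =
  \int[lebesgue_measure]_(r in `[a, b]) q r +
  \int[lebesgue_measure]_(r in `[b, c]) q r.
Proof.
move=> cq ab bc; have := @Rintegral_itvB R q (BLeft a) (BRight c) b
  (integrable_continuous a c cq).
rewrite !bnd_simp => /(_ ab bc) /eqP; rewrite subr_eq => /eqP ->.
rewrite addrC Rintegral_itv_obnd_cbnd//.
apply: integrableS (integrable_continuous b c cq) => //.
by move=> r; rewrite /= !in_itv /= => /andP[/ltW -> ->].
Qed.

Lemma Rintegral_cell q (a b e : R) : continuous q -> a <= b ->
  (forall r, r \in `[a, b] -> `|q r - q b| <= e) ->
  `|\int[lebesgue_measure]_(r in `[a, b]) q r - (b - a) * q b| <= (b - a) * e.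
Proof.
move=> cq ab qe.
have cc (c : R) : continuous (fun _ : R => c) by move=> x; exact: cvg_cst.
have Ic (c : R) : \int[lebesgue_measure]_(r in `[a, b]) c = (b - a) * c.
  rewrite Rintegral_cst// mulrC; congr (_ * _).
  rewrite -[RHS]/(fine (b - a)%:E); congr fine.
  rewrite [LHS](lebesgue_measure_itv `[a, b]) /= lte_fin.
  have [lt_ab|ba] := ltP a b; first by rewrite EFinB.
  by rewrite (_ : a = b) ?subrr//; apply/eqP; rewrite eq_le ab.
have cqb : continuous (fun r => q r - q b).
  by move=> x; apply: cvgB; [exact: cq|exact: cvg_cst].
have cn : continuous (fun r => `|q r - q b|).
  by move=> x; apply: cvg_norm; exact: cqb.
have Iq := integrable_continuous a b cq; have Iqb := integrable_continuous a b cqb.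
have In := integrable_continuous a b cn; have Iqbb := integrable_continuous a b (cc (q b)).
have Ie := integrable_continuous a b (cc e).
rewrite -Ic -RintegralB//; apply: le_trans (le_normr_Rintegral _ _) _ => //.
by rewrite -Ic; apply: le_Rintegral => // r rab; exact: qe.
Qed.

(** Right-endpoint sums on [[t - h, t]] with [n.+1] equal cells, counted backward from [t]. Only
    values at fixed times enter, so along a random path each sum is measurable. *)
Definition riemann_sum q (h t : R) (n : nat) : R :=
  \sum_(i < n.+1) h / n.+1%:R * q (t - i%:R * (h / n.+1%:R)).

Lemma riemann_sum_cvg q (h t : R) : continuous q -> 0 < h ->
  riemann_sum q h t n @[n --> \oo] -->
  \int[lebesgue_measure]_(r in `[t - h, t]) q r.
Proof.
move=> cq h0; apply/cvgrPdist_le => e e0.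
have eh : 0 < e / h by rewrite divr_gt0.
have [d d0 dP] := heine (t - h) t cq eh.
near=> n; set c := h / n.+1%:R.
have n0 : 0 < n.+1%:R :> R by rewrite ltr0n.
have c0 : 0 < c by rewrite divr_gt0.
have cd : c < d.
  rewrite ltr_pdivrMr// mulrC -ltr_pdivrMr//.
  by apply: lt_le_trans (_ : n%:R <= _); [near: n; exact: nbhs_infty_gtr|rewrite ler_nat].
have nc : n.+1%:R * c = h by rewrite mulrC divfK ?gt_eqF.
(* The error is accumulated over the last [k] cells, each contributing at most its length times
   [e / h]. *)
have ind k : (k <= n.+1)%N ->
    `|\int[lebesgue_measure]_(r in `[t - k%:R * c, t]) q r -
      \sum_(i < k) c * q (t - i%:R * c)| <= k%:R * c * (e / h).
  elim: k => [|k IH] kn.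
    by rewrite mul0r subr0 big_ord0 set_itv1 Rintegral_set1 subr0 normr0 !mul0r.
  have kc : t - k.+1%:R * c <= t - k%:R * c.
    by rewrite lerD2l lerN2 ler_wpM2r ?ler_nat// ltW.
  have k1c : t - k%:R * c <= t by rewrite gerBl mulr_ge0// ltW.
  rewrite (Rintegral_split cq kc k1c) big_ord_recr /= [X in _ - X]addrC opprD addrACA.
  apply: le_trans (ler_normD _ _) _.
  have ck : (t - k%:R * c) - (t - k.+1%:R * c) = c by rewrite -natr1; ring.
  have -> : k.+1%:R * c * (e / h) = c * (e / h) + k%:R * c * (e / h).
    by rewrite -natr1; ring.
  apply: lerD; last first.
    exact/IH/ltnW.
  have := @Rintegral_cell q _ _ (e / h) cq kc; rewrite ck; apply => r.
  rewrite in_itv /= => /andP[r1 r2]; apply/ltW/dP.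
    by rewrite in_itv /= k1c andbT lerD2l lerN2 -nc ler_wpM2r ?ler_nat ?(ltW c0)// ltnW.
  apply: le_lt_trans cd; rewrite ler_norml -ck; apply/andP; split; lra.
have := ind n.+1 (leqnn _); rewrite nc => H; apply: le_trans H _.
by rewrite mulrC divfK ?gt_eqF.
Unshelve. all: by end_near. Qed.

End RiemannSums.

(** * Measurable version of the integral of the norm of [z] over one step *)

Section Zeta.
Context {R : realType} {H : completeNormedModType R}.
Hypothesis sepH : separable H.
Variables (Pr : probability (wienerSpace H) R) (z : path0 H -> H) (h : R).
Hypothesis Pr_inv : forall tau (A : set (wienerSpace H)), measurable A ->
  Pr (wshift tau @^-1` A) = Pr A.
Hypothesis mz : borel_measurable z.
Hypothesis iz : (\int[Pr]_w `|z w|%:E < +oo)%E.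
Hypothesis h0 : 0 < h.

Let rs n (w : path0 H) : R := riemann_sum (fun t => `|z (wshift t w)|) h 0 n.

Let c0 n : 0 <= h / n.+1%:R.
Proof. by rewrite divr_ge0// ltW. Qed.

Let rs0 n w : 0 <= rs n w.
Proof. by apply: sumr_ge0 => i _; rewrite mulr_ge0. Qed.

Lemma measurable_norm_wshift t :
  measurable_fun setT ((fun w => `|z (wshift t w)|) : wienerSpace H -> R).
Proof.
have mz' := @measurable_borel_norm _ _ _ (wienerSpace H) z mz.
exact: (measurableT_comp mz' (measurable_wshift sepH t)).
Qed.

Let mrs n : measurable_fun setT ((fun w => (rs n w)%:E) : wienerSpace H -> \bar R).
Proof.
apply/measurable_EFinP; apply: measurable_sum => i.
by apply: measurable_funM; [exact: measurable_cst|exact: measurable_norm_wshift].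
Qed.

Let ez (w : wienerSpace H) : \bar R := limn_einf (fun n => (rs n w)%:E).

Let ez0 w : (0 <= ez w)%E.
Proof.
rewrite /ez limn_einf_lim; apply: lime_ge; first exact: is_cvg_einfs.
by apply: nearW => n; apply: le_ereal_inf_tmp => _ [m _ <-]; rewrite lee_fin.
Qed.

Let mez : measurable_fun setT ez.
Proof.
rewrite (_ : ez = -%E \o (fun w => limn_esup (fun n => - (rs n w)%:E))%E); last first.
  by [].
apply: measurableT_comp => //; apply: measurable_fun_limn_esup => n.
exact: measurableT_comp.
Qed.

(** The lower limit [ez] is defined and measurable on all paths, continuous or not; on continuous
    ones it is the integral over [[- h, 0]]. *)
Definition zeta w : R := fine (ez w).

Lemma zeta_ge0 w : 0 <= zeta w.
Proof. exact: fine_ge0. Qed.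

Lemma measurable_zeta : measurable_fun setT (zeta : wienerSpace H -> R).
Proof. by apply: measurableT_comp => //; exact: fine_measurable. Qed.

Lemma integral_norm_wshift t :
  (\int[Pr]_w (`|z (wshift t w)|)%:E = \int[Pr]_w `|z w|%:E)%E.
Proof.
apply: (@ge0_integral_comp_invariant _ (wienerSpace H) R Pr (wshift t) _ _
  (fun w => `|z w|%:E)) => //.
- exact: measurable_wshift.
- exact: Pr_inv.
- by apply/measurable_EFinP; exact: (@measurable_borel_norm _ _ _ (wienerSpace H)).
Qed.

(** By invariance each Riemann sum has expectation [h] times that of the norm of [z], and Fatou's
    lemma transfers this bound to the lower limit. *)
Lemma integral_zeta : (\int[Pr]_w (zeta w)%:E < +oo)%E.
Proof.
have Ers n : (\int[Pr]_w (rs n w)%:E = h%:E * \int[Pr]_w `|z w|%:E)%E.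
  under eq_integral do rewrite /rs /riemann_sum -sumEFin.
  rewrite ge0_integral_sum//; last 2 first.
  - move=> i; apply/measurable_EFinP; apply: measurable_funM.
      exact: measurable_cst.
    exact: measurable_norm_wshift.
  - by move=> i w _; rewrite lee_fin mulr_ge0.
  transitivity (\sum_(i < n.+1) (h / n.+1%:R)%:E * \int[Pr]_w `|z w|%:E)%E.
    apply: eq_bigr => i _; under eq_integral do rewrite EFinM.
    have mN : measurable_fun setT ((fun w =>
        (`|z (wshift (0 - i%:R * (h / n.+1%:R)) w)|)%:E) : wienerSpace H -> \bar R).
      by apply/measurable_EFinP; exact: measurable_norm_wshift.
    by rewrite ge0_integralZl_EFin// integral_norm_wshift.
  rewrite -ge0_sume_distrl; last by move=> i _; rewrite lee_fin.
  congr (_ * _)%E; rewrite sumEFin sumr_const card_ord.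
  rewrite -(mulr_natl (h / _)) mulrCA divff ?mulr1 ?pnatr_eq0//.
apply: (@le_lt_trans _ _ (\int[Pr]_w ez w)%E).
  apply: ge0_le_integral => //.
  - by move=> w _; rewrite lee_fin zeta_ge0.
  - by apply/measurable_EFinP; exact: measurable_zeta.
  (* [fine] sends an infinite lower limit to 0, so [zeta] stays below [ez] on every path. *)
  - move=> w _; rewrite /zeta; have := ez0 w; case: (ez w) => //= *; exact: leey.
apply: le_lt_trans (fatou Pr measurableT mrs _) _.
  by move=> n w _; rewrite lee_fin.
rewrite (_ : (fun n => _) = fun=> (h%:E * \int[Pr]_w `|z w|%:E)%E); last first.
  by apply/funext => n; rewrite Ers.
rewrite (cvg_limn_einf_sup (cvg_cst _)).1.
by rewrite lte_mul_pinfty// lee_fin ltW.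
Qed.

Lemma zetaE tau w : continuous (fun t => z (wshift t w)) ->
  zeta (wshift tau w) = \int[lebesgue_measure]_(r in `[tau - h, tau]) `|z (wshift r w)|.
Proof.
move=> cz; have cn : continuous (fun t => `|z (wshift t w)|).
  by move=> x; apply: cvg_norm; exact: cz.
have cv := riemann_sum_cvg (t := tau) cn h0.
rewrite /zeta /ez (_ : (fun n => _) = fun n =>
    (riemann_sum (fun t => `|z (wshift t w)|) h tau n)%:E); last first.
  apply/funext => n; congr EFin; apply: eq_bigr => i _.
  by rewrite wshiftD sub0r [_ + tau]addrC.
suff cvE : (fun n => (riemann_sum (fun t => `|z (wshift t w)|) h tau n)%:E) @ \oo -->
    (\int[lebesgue_measure]_(r in `[tau - h, tau]) `|z (wshift r w)|)%:E.
  by rewrite (cvg_limn_einf_sup cvE).1.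
by apply: cvg_EFin; first exact: nearW.
Qed.

End Zeta.

(** * Tempered paths *)

Section Tempered.
Context {R : realType} {H : completeNormedModType R}.
Variables (F : H -> H) (L : R).
Hypothesis L0 : 0 <= L.
Hypothesis FL : forall x y, `|F x - F y| <= L * `|x - y|.
Hypothesis cF : continuous F.
Variables (d z : R -> H) (h B B0 beta eta : R).
Hypotheses (cd : continuous d) (cz : continuous z) (h0 : 0 < h).
Hypotheses (eta0 : eta < 0) (be : beta < eta).

Let cell n (t : R) := - (n.+1%:R * h) <= t /\ t <= - (n%:R * h).

Lemma cell_exists t : t <= 0 -> exists n, cell n t.
Proof.
move=> t0; exists (Num.truncn (- t / h)); have th : 0 <= - t / h.
  by rewrite divr_ge0 ?oppr_ge0 ?(ltW h0).
split.
  by rewrite lerNl -ler_pdivrMr// ltW// truncnS_gt.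
by rewrite lerNr -ler_pdivlMr// truncn_le.
Qed.

Hypothesis dB : forall n t, cell n t -> `|d t| <= B0 * (B * expR (- eta * (n%:R * h))).
Hypothesis zB : forall n,
  \int[lebesgue_measure]_(r in `[- (n.+1%:R * h), - (n%:R * h)]) `|z r| <=
  B * expR (- eta * (n%:R * h)).
Hypotheses (B_ge0 : 0 <= B) (B0_ge0 : 0 <= B0).

(** On cell [n] one has [t <= - (n%:R * h)], and as [eta < 0] this gives
    [- eta * (n%:R * h) <= eta * t]. *)
Lemma tempered_bound t : t <= 0 -> expR (- (eta * t)) * `|d t| <= B0 * B.
Proof.
move=> t0; have [n [tn nt]] := cell_exists t0.
rewrite expRN ler_pdivrMl ?expR_gt0//; apply: le_trans (dB (conj tn nt)) _.
rewrite mulrA [leRHS]mulrC ler_wpM2l ?mulr_ge0// ler_expR mulNr -mulrN.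
by rewrite ler_nM2l.
Qed.

Let b r := expR (- (beta * r)) * `|F (d r + z r)|.

Let cb : continuous b.
Proof.
move=> x; apply: cvgM.
  apply: (@continuous_comp _ _ _ (fun r => - (beta * r)) expR); last exact: continuous_expR.
  by apply: cvgN; apply: cvgMr; exact: cvg_id.
apply: cvg_norm; apply: (@continuous_comp _ _ _ (fun r => d r + z r) F); last exact: cF.
by apply: cvgD; [exact: cd|exact: cz].
Qed.

Let A := h * (`|F 0| + L * (B0 * B)) + L * B.

Let A_ge0 : 0 <= A.
Proof. by rewrite addr_ge0 ?mulr_ge0 ?addr_ge0 ?mulr_ge0 // ltW. Qed.

(** On cell [n] the weight is at most [expR (beta * (n%:R * h))], while the forcing has integral at
    most [A] times [expR (- eta * (n%:R * h))]; the product is geometric in [n]. *)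
Lemma tempered_cell n :
  \int[lebesgue_measure]_(r in `[- (n.+1%:R * h), - (n%:R * h)]) b r <=
  A * expR ((beta - eta) * h) ^+ n.
Proof.
set p := - (n.+1%:R * h); set q := - (n%:R * h).
have pq : p <= q by rewrite lerN2 ler_wpM2r ?ler_nat// ltW.
have qp : q - p = h by rewrite /p /q -natr1; ring.
pose E := expR (- eta * (n%:R * h)).
(* This lets the constant term, the norm of [F 0], be absorbed into the exponential bound. *)
have E1 : 1 <= E.
  by rewrite -expR0 ler_expR mulr_ge0 ?mulr_ge0 ?oppr_ge0// ltW.
have cn : continuous (fun r => `|z r|) by move=> x; apply: cvg_norm; exact: cz.
pose M r := expR (beta * (n%:R * h)) * (`|F 0| + L * (B0 * (B * E)) + L * `|z r|).
have cM : continuous M.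
  move=> x; apply: cvgM; first exact: cvg_cst.
  by apply: cvgD; [exact: cvg_cst|apply: cvgM; [exact: cvg_cst|exact: cn]].
apply: (@le_trans _ _ (\int[lebesgue_measure]_(r in `[p, q]) M r)).
  apply: le_Rintegral => //; [exact: integrable_continuous..|].
  move=> r /=; rewrite in_itv /= => /andP[pr rq]; rewrite /b /M.
  have b0 : beta < 0 by exact: lt_trans eta0.
  apply: ler_pM; rewrite ?expR_ge0//.
    by rewrite ler_expR -mulrN ler_nM2l// lerNr.
  apply: le_trans (lipschitz_growth FL _) _; rewrite -addrA lerD2l -mulrDr.
  apply: ler_wpM2l => //; apply: le_trans (ler_normD _ _) _; rewrite lerD2r.
  exact: dB.
pose c := `|F 0| + L * (B0 * (B * E)).
have Ic : \int[lebesgue_measure]_(r in `[p, q]) c = h * c.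
  have := @Rintegral_cell R (fun=> c) p q 0 _ pq _; rewrite qp mulr0.
  move=> H1; apply/eqP; rewrite -subr_eq0 -normr_le0; apply: H1.
    by move=> x; exact: cvg_cst.
  by move=> r _; rewrite subrr normr0.
have Iz : lebesgue_measure.-integrable `[p, q] (EFin \o (fun r => `|z r|)).
  exact: integrable_continuous.
have cc : continuous (fun _ : R => c) by move=> x; exact: cvg_cst.
have cLn : continuous (fun r => L * `|z r|).
  by move=> x; apply: cvgM; [exact: cvg_cst|exact: cn].
have IM : \int[lebesgue_measure]_(r in `[p, q]) M r = expR (beta * (n%:R * h)) *
    (h * c + L * \int[lebesgue_measure]_(r in `[p, q]) `|z r|).
  rewrite /M RintegralZl//; last first.
    apply: (@integrable_continuous R (fun r => c + L * `|z r|)) => x.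
    by apply: cvgD; [exact: cc|exact: cLn].
  congr (_ * _); rewrite RintegralD//; first by rewrite RintegralZl// Ic.
  - exact: integrable_continuous.
  - exact: (@integrable_continuous R (fun r => L * `|z r|)).
have -> : expR ((beta - eta) * h) ^+ n = expR (beta * (n%:R * h)) * E.
  by rewrite -expRM_natl /E -expRD; congr expR; ring.
rewrite IM.
rewrite [leRHS]mulrCA ler_wpM2l ?expR_ge0//.
have zn := zB n; rewrite -/p -/q -/E in zn.
have F0E : `|F 0| <= `|F 0| * E by rewrite ler_peMr.
have h0' := ltW h0.
apply: le_trans (_ : h * (`|F 0| * E + L * (B0 * (B * E))) + L * (B * E) <= _).
  apply: lerD; last exact: ler_wpM2l.
  by rewrite ler_wpM2l// /c lerD2r.
by rewrite /A le_eqVlt; apply/orP; left; apply/eqP; ring.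
Qed.

(** The cells contribute a geometric series of ratio below 1, because [beta < eta]; monotone
    convergence then passes from [[- (n%:R * h), 0]] to the half-line. *)
Lemma tempered_integrable : lebesgue_measure.-integrable `]-oo, 0] (EFin \o b).
Proof.
pose q := expR ((beta - eta) * h).
have q1 : q < 1 by rewrite expR_lt1 nmulr_rlt0// subr_lt0.
have q0 : 0 <= q by exact: expR_ge0.
have oq : 0 < 1 - q by rewrite subr_gt0.
have b0 r : 0 <= b r by rewrite mulr_ge0// expR_ge0.
have ind n : \int[lebesgue_measure]_(r in `[- (n%:R * h), 0]) b r <=
    A / (1 - q) * (1 - q ^+ n).
  elim: n => [|n IH].
    by rewrite mul0r oppr0 set_itv1 Rintegral_set1 expr0 subrr mulr0.
  have pq : - (n.+1%:R * h) <= - (n%:R * h) by rewrite lerN2 ler_wpM2r ?ler_nat// ltW.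
  have qn : - (n%:R * h) <= 0 by rewrite oppr_le0 mulr_ge0// ltW.
  rewrite (Rintegral_split cb pq qn); apply: le_trans (lerD (tempered_cell n) IH) _.
  rewrite -/q le_eqVlt; apply/orP; left; apply/eqP; rewrite exprS; field.
  by rewrite gt_eqF.
have fin n : (\int[lebesgue_measure]_(r in [set` `[- (n%:R * h), 0]%R]) (b r)%:E <=
    (A / (1 - q))%:E)%E.
  have Ib := integrable_continuous (- (n%:R * h)) 0 cb.
  rewrite -[leLHS]fineK; last exact: integrable_fin_num.
  rewrite lee_fin; apply: le_trans (ind n) _.
  by rewrite ler_piMr ?divr_ge0// ?(ltW oq)// lerBlDr lerDl exprn_ge0.
apply/integrableP; split.
  apply/measurable_EFinP.
  apply: (@subspace_continuous_measurable_fun R `]-oo, 0] b) => //.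
  exact: continuous_subspaceT.
under eq_integral do rewrite /= ger0_norm//.
apply: (@le_lt_trans _ _ (A / (1 - q))%:E); last exact: ltry.
pose G (n : nat) := [set` `[- (n%:R * h), 0]].
have -> : [set` `]-oo, 0]] = \bigcup_n G n :> set R.
  apply/seteqP; split => [r|r [n _]]; rewrite /G /= !in_itv /=; last by case/andP.
  move=> r0; have [n [rn _]] := cell_exists r0; exists n.+1 => //=.
  by rewrite in_itv /= rn.
have mb n : measurable_fun (G n) (fun r => (b r)%:E).
  by have /integrableP[] := integrable_continuous (- (n%:R * h)) 0 cb.
have ndG : nondecreasing_seq G.
  apply/nondecreasing_seqP => n; apply/subsetPset => r; rewrite /G /= !in_itv /=.
  move=> /andP[nr ->]; rewrite andbT; apply: le_trans nr.
  by rewrite lerN2 ler_wpM2r ?ler_nat// ltW.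
have cv : (\int[lebesgue_measure]_(r in G n) (b r)%:E @[n --> \oo] -->
    \int[lebesgue_measure]_(r in \bigcup_n G n) (b r)%:E)%E.
  apply: ge0_nondecreasing_set_cvg_integral => //.
  - by move=> n; exact: measurable_itv.
  - by move=> n r _; rewrite lee_fin.
rewrite -(cvg_lim _ cv)//; apply: lime_le; first by apply/cvg_ex; eexists; exact: cv.
by apply: nearW => n; exact: fin.
Qed.

End Tempered.

(** * The difference of the stationary solutions *)

Section StationaryDifference.
Context {R : realType} {H : completeNormedModType R}.

Lemma ae_forall_countable d (T : measurableType d) (mu : {measure set T -> \bar R})
    (I : countType) (Q : I -> T -> Prop) :
  (forall i, \forall x \ae mu, Q i x) -> \forall x \ae mu, forall i, Q i x.
Proof.
move=> aeQ; have : \forall x \ae mu, forall n,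
    if @unpickle I n is Some i then Q i x else True.
  apply: ae_foralln => n; case: (unpickle n) => [i|]; first exact: aeQ.
  exact: aeW.
by apply: filterS => x Qx i; have := Qx (pickle i); rewrite pickleK.
Qed.

Hypothesis sepH : separable H.
Variable ip : {dot H for @idfun R}.
Hypothesis hH : hilbert ip.
Variables (Pr : probability (wienerSpace H) R) (S : R -> {linear H -> H}).
Hypothesis hS : strongly_continuous_group S.
Hypothesis bS : exists2 C : R, 1 <= C &
  forall t x, `|t| <= 1 -> `|S t x| <= C * `|x|.
Variables (F : H -> H) (sigma : R) (u z : path0 H -> H).
Hypothesis cF : continuous F.
Hypothesis hu : stationary_solution Pr S F sigma u.
Hypothesis hz : stationary_solution Pr S (fun=> 0) sigma z.

Let cS t : continuous (S t). Proof. by case: hS. Qed.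

(* The two solutions are driven by the same Wiener integral, which cancels. *)
Lemma stationary_difference_at s t : s <= t -> \forall w \ae Pr,
  is_integral `[s, t] (fun r => S (t - r) (F (u (wshift r w))))
    ((u (wshift t w) - z (wshift t w)) -
     S (t - s) (u (wshift s w) - z (wshift s w))).
Proof.
move=> st; have [_ _ /(_ _ _ st)[X IX aeu]] := hu.
have [_ _ /(_ _ _ st)[Y IY aez]] := hz.
have aeXY := wiener_integral_unique sepH st (fun r => @cS (t - r)) IX IY.
apply: (@filterS3 _ _ (ae_filter_ringOfSetsType Pr) _ _ _ _ _ aeXY aeu aez) => w XY [v Iv uE] [v' Iv' zE].
have v'0 : v' = 0.
  apply: (weak_separation hH) => phi cphi; rewrite linear0.
  have [_ /(_ _ cphi)[_]] := Iv'.
  under eq_integral do rewrite !linear0.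
  by rewrite integral0 => -[].
rewrite (_ : _ - _ - _ = v)// uE zE XY v'0 addr0 linearB /=.
set a := S _ _; set b := S _ _; set c := sigma *: _.
by rewrite opprD (addrC (- b)) addrA addrK opprB addrA subrK [a + v]addrC addrK.
Qed.

(** The exceptional null set depends on the pair of times, so only rational pairs are collected;
    path continuity extends the identity to all times. *)
Lemma stationary_difference_mild : \forall w \ae Pr,
  [/\ continuous (fun t => u (wshift t w)), continuous (fun t => z (wshift t w)) &
      mild S (fun t => u (wshift t w) - z (wshift t w))
             (fun t => F (u (wshift t w)))].
Proof.
have [_ aecu _] := hu; have [_ aecz _] := hz.
have aeI : \forall w \ae Pr, forall pq : rat * rat, ratr pq.1 <= ratr pq.2 :> R ->
    is_integral `[ratr pq.1, ratr pq.2 : R]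
      (fun r => S (ratr pq.2 - r) (F (u (wshift r w))))
      ((u (wshift (ratr pq.2) w) - z (wshift (ratr pq.2) w)) -
       S (ratr pq.2 - ratr pq.1)
         (u (wshift (ratr pq.1) w) - z (wshift (ratr pq.1) w))).
  apply: ae_forall_countable => -[p q] /=.
  have [pq|qp] := leP (ratr p : R) (ratr q).
    by apply: (@filterS _ _ (ae_filter_ringOfSetsType Pr) _ _ _ (stationary_difference_at pq)).
  by apply: aeW => w.
apply: (@filterS3 _ _ (ae_filter_ringOfSetsType Pr) _ _ _ _ _ aecu aecz aeI) => w cu cz I; split => //.
have SD r t x : S (r + t) x = S r (S t x) by case: hS.
have cg : continuous (fun r => F (u (wshift r w))).
  move=> x; apply: (@continuous_comp _ _ _ (fun r => u (wshift r w)) F); last exact: cF.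
  exact: cu.
apply: (mild_of_rat hS bS) => //.
  by move=> x; apply: cvgB; [exact: cu|exact: cz].
move=> p q pq; have := I (p, q) pq => /=.
move=> /(is_integral_linear (measurable_itv _) (@cS (- ratr q)) _) J.
have {J} := J _; rewrite linearB -SD addrA addNr sub0r => J.
have cc : {within `[ratr p, ratr q : R], continuous
    (fun r => S (ratr q - r) (F (u (wshift r w))))}.
  apply: continuous_subspaceT; apply: (group_continuous hS bS) => // x.
  by apply: cvgB; [exact: cvg_cst|exact: cvg_id].
move: (J cc); apply: eq_is_integral => // r _.
by rewrite -SD addrA addNr sub0r.
Qed.

End StationaryDifference.

(** * Equality of the manifolds *)

Lemma lipschitz_continuous (R : realType) (H : normedModType R) (F : H -> H) (L : R) :
  0 <= L -> (forall x y, `|F x - F y| <= L * `|x - y|) -> continuous F.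
Proof.
move=> L0 FL x; apply/cvgrPdist_lt => e e0.
have L1 : 0 < L + 1 by rewrite ltr_wpDl.
near=> y; apply: le_lt_trans (FL _ _) _.
apply: (@le_lt_trans _ _ ((L + 1) * `|x - y|)); first by rewrite ler_wpM2r// lerDl.
rewrite mulrC -ltr_pdivlMr//; near: y; apply: cvgr_dist_lt; first exact: cvg_id.
by rewrite divr_gt0.
Unshelve. all: by end_near. Qed.


Section ManifoldEquality.
Context {R : realType} {H : completeNormedModType R}.
Variable ip : {dot H for @idfun R}.
Hypothesis hH : hilbert ip.
Variables (S : R -> {linear H -> H}) (P : {linear H -> H}).
Variables (alpha beta K eta : R).
Hypothesis hS : strongly_continuous_group S.
Hypothesis hd : exponential_dichotomy S P alpha beta K.
Variables (F : H -> H) (u z : path0 H -> H) (w : path0 H).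
Hypothesis cF : continuous F.
Let us s := u (wshift s w).
Let zs s := z (wshift s w).
Let d s := us s - zs s.
Hypotheses (cu : continuous us) (cz : continuous zs).
Hypothesis ld : lyapunov_perron S P eta (P (d 0)) (fun s _ => F (us s)) d.

Let PP x : P (P x) = P x. Proof. by case: hd => _ []. Qed.

Let w0 : wshift 0 w = w. Proof. exact: wshift0. Qed.

Lemma manifold_eq : manifold S P eta F u w =
  [set x + z w | x in manifold_tilde S P eta F z w].
Proof.
have cd : continuous d by move=> x; apply: cvgB; [exact: cu|exact: cz].
apply/seteqP; split => [x [xi [U [[xi' _ <-] LU ->]]]|].
  (* [V = U + d]: adding the equation of [d] cancels [F (us s)] from the forcing and turns the
     initial value [xi - P u] into [xi - P z]. *)
  have LV : lyapunov_perron S P eta (P xi' - P (u (wshift 0 w)) + 1 *: P (d 0))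
      (fun s y => F (y + zs s)) (fun s => U s + 1 *: d s).
    apply: (lyapunov_perron_lincomb hS hd LU ld).
      by move=> s _ /=; rewrite !scale1r /d -addrA subrK [RHS]subrK.
    apply: within_continuous_postcomp => //.
    have [[cU _] _] := LU; move=> s; apply: cvgD.
      apply: cvgD; first exact: cU.
      by apply: cvgZr; exact: (continuous_subspaceT cd).
    exact: (continuous_subspaceT cz).
  have x0E : P xi' - P (u (wshift 0 w)) + 1 *: P (d 0) = P xi' - P (z (wshift 0 w)).
    by rewrite scale1r /d /us /zs linearB /= addrA subrK.
  rewrite x0E in LV.
  have PV : P (U 0 + 1 *: d 0) = P xi' - P (z (wshift 0 w)).
    by apply: (lyapunov_perron_proj hH hS hd LV); rewrite linearB /= !PP.
  exists (U 0 + 1 *: d 0); last first.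
    by rewrite scale1r /d /us /zs w0 -addrA subrK.
  exists (P xi'), (fun s => U s + 1 *: d s); split; [by exists xi'|by []|].
  by rewrite PV [RHS]addrC subrK.
move=> _ [_ [xi [V [[xi' _ <-] LV ->]]] <-].
have PV : P (V 0) = P xi' - P (z (wshift 0 w)).
  by apply: (lyapunov_perron_proj hH hS hd LV); rewrite linearB /= !PP.
(* The inverse substitution [U = V - d], with the same parameter [xi]. *)
exists (P xi'), (fun s => V s + (-1) *: d s); split; first by exists xi'.
  have x0E : P xi' - P (z (wshift 0 w)) + (-1) *: P (d 0) = P xi' - P (u (wshift 0 w)).
    by rewrite scaleN1r /d /us /zs linearB /= opprB addrA subrK.
  rewrite /is_Ubar -x0E; apply: (lyapunov_perron_lincomb hS hd LV ld).
    by move=> s _ /=; rewrite !scaleN1r /d opprB -addrA subrK.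
  have [[cV _] _] := LV.
  have cW : {within `]-oo, 0], continuous (fun s => V s + (-1) *: d s + us s)}.
    move=> s; apply: cvgD; last exact: (continuous_subspaceT cu).
    apply: cvgD; first exact: cV.
    by apply: cvgZr; exact: (continuous_subspaceT cd).
  have cFW := within_continuous_postcomp cF cW.
  have cFu : {within `]-oo, 0], continuous (fun s => F (us s))}.
    by apply: within_continuous_postcomp => //; exact: continuous_subspaceT.
  by move=> s; apply: cvgB; [exact: cFW|exact: cFu].
rewrite -PV [P _ + _]addrC subrK scaleN1r /d /us /zs w0 opprB.
by rewrite -addrA subrK.
Qed.

End ManifoldEquality.

(** * Subexponential growth of the stationary solutions backward in time *)

Section StationaryGrowth.
Context {R : realType} {H : completeNormedModType R}.
Hypothesis sepH : separable H.
Variables (Pr : probability (wienerSpace H) R) (u z : path0 H -> H).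
Hypothesis Pr_inv : forall tau (A : set (wienerSpace H)), measurable A ->
  Pr (wshift tau @^-1` A) = Pr A.
Hypotheses (mu : borel_measurable u) (mz : borel_measurable z).
Hypothesis iz : (\int[Pr]_w `|z w|%:E < +oo)%E.
Variables (h eps c : R).
Hypotheses (h0 : 0 < h) (eps0 : 0 < eps) (c1 : 1 <= c).

Lemma iter_wshift t n (w : path0 H) :
  iter n (wshift (- t)) w = wshift (- (n%:R * t)) w.
Proof.
elim: n => [|n IH]; first by rewrite mul0r oppr0 wshift0.
by rewrite iterS IH wshiftD -natr1 mulrDl mul1r opprD addrC.
Qed.

Let zt := zeta z h.
Let size_uz (w : path0 H) := 1 + (`|u w| + `|z w| + zt w).

Let size_ge1 w : 1 <= size_uz w.
Proof. by rewrite lerDl !addr_ge0// zeta_ge0. Qed.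

(** Taking logarithms turns the multiplicative step into an additive one, and [ln (1 + x) <= x]
    bounds the increment by an integrable function even though the size itself may have no
    moment. *)
Lemma stationary_subexponential : \forall w \ae Pr,
  (forall n, let v := wshift (- (n%:R * h)) w in let v' := wshift (- h) v in
     size_uz v' <= c * size_uz v * (1 + (`|z v'| + zt v'))) ->
  exists2 B, 0 <= B & forall n, let v := wshift (- (n%:R * h)) w in
    size_uz v <= B * expR (n%:R * eps).
Proof.
pose f w := ln (size_uz w).
pose g w := ln c + (`|z (wshift (- h) w)| + zt (wshift (- h) w)).
have mth := measurable_wshift sepH (- h).
have mnu := @measurable_borel_norm _ _ _ (wienerSpace H) u mu.
have mnz := @measurable_borel_norm _ _ _ (wienerSpace H) z mz.
have mzt : measurable_fun setT (zt : wienerSpace H -> R) by exact: measurable_zeta.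
have mf : measurable_fun setT (f : wienerSpace H -> R).
  apply: (measurableT_comp (@measurable_ln R)).
  apply: measurable_funD; first exact: measurable_cst.
  by apply: measurable_funD => //; exact: measurable_funD.
have mzz : measurable_fun setT ((fun w => `|z w| + zt w) : wienerSpace H -> R).
  exact: measurable_funD.
have mg : measurable_fun setT (g : wienerSpace H -> R).
  apply: measurable_funD; first exact: measurable_cst.
  exact: (measurableT_comp mzz mth).
have lc0 : 0 <= ln c by rewrite ln_ge0.
have zz0 w : 0 <= `|z w| + zt w by rewrite addr_ge0// zeta_ge0.
have g0 w : 0 <= g w by rewrite addr_ge0.
have ig : (\int[Pr]_w (g w)%:E < +oo)%E.
  have -> : (\int[Pr]_w (g w)%:E = \int[Pr]_w ((ln c)%:E +
      (`|z (wshift (- h) w)| + zt (wshift (- h) w))%:E))%E by [].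
  have mE : measurable_fun setT
      ((fun w => (`|z w| + zt w)%:E) : wienerSpace H -> \bar R).
    exact/measurable_EFinP.
  have mEth : measurable_fun setT ((fun w => (`|z (wshift (- h) w)| +
      zt (wshift (- h) w))%:E) : wienerSpace H -> \bar R).
    exact: (measurableT_comp mE mth).
  rewrite ge0_integralD//; last by move=> w _; rewrite lee_fin.
  rewrite integral_cst//; apply: lte_add_pinfty.
    rewrite lte_mul_pinfty ?lee_fin//; apply: le_lt_trans (probability_le1 Pr _) _.
      exact: measurableT.
    exact: ltry.
  rewrite (@ge0_integral_comp_invariant _ (wienerSpace H) R Pr (wshift (- h)) mth
    (Pr_inv (- h)) (fun w => (`|z w| + zt w)%:E))//.
  under eq_integral do rewrite EFinD.
  have mzE : measurable_fun setT ((fun w => `|z w|%:E) : wienerSpace H -> \bar R).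
    exact/measurable_EFinP.
  have mztE : measurable_fun setT ((fun w => (zt w)%:E) : wienerSpace H -> \bar R).
    exact/measurable_EFinP.
  have iD : (\int[Pr]_w (`|z w|%:E + (zt w)%:E) =
      \int[Pr]_w `|z w|%:E + \int[Pr]_w (zt w)%:E)%E.
    by apply: ge0_integralD => // w _; rewrite lee_fin// zeta_ge0.
  by rewrite iD lte_add_pinfty// integral_zeta.
have := @sublinear_growth _ (wienerSpace H) R Pr (wshift (- h)) mth (Pr_inv (- h))
  f g eps mf mg g0 ig eps0.
apply: (@filterS _ _ (ae_filter_ringOfSetsType Pr)) => w growth step.
have spos v : 0 < size_uz v by exact: lt_le_trans (size_ge1 v).
have [n|B0 HB] := growth _.
  rewrite iterS iter_wshift; have := step n.
  set v := wshift _ w; set v' := wshift (- h) v => /= le_v'.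
  have c0 : 0 < c by exact: lt_le_trans c1.
  have z1 : 0 < 1 + (`|z v'| + zt v') by rewrite ltr_pwDl.
  rewrite /f /g -/v'; apply: le_trans (_ : ln (c * size_uz v * (1 + (`|z v'| + zt v'))) <= _).
    by rewrite ler_ln ?posrE// !mulr_gt0.
  rewrite !lnM ?posrE ?mulr_gt0//.
  have : ln (1 + (`|z v'| + zt v')) <= `|z v'| + zt v'.
    by apply: le_ln1Dx; apply: lt_le_trans (zz0 v'); rewrite ltrN10.
  lra.
exists (expR B0); first exact: expR_ge0.
move=> n /=; have := HB n; rewrite iter_wshift => fn.
by rewrite -[leLHS]lnK ?posrE// -expRD ler_expR.
Qed.

End StationaryGrowth.

(** A Wiener integral is square integrable, and the norm of [X] is at most one plus its square. *)
Lemma wiener_ninfty_integrable (R : realType) (H : completeNormedModType R)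
    (Pr : probability (wienerSpace H) R) (Phi : R -> H -> H) (b sigma : R)
    (X z : path0 H -> H) :
  is_wiener_integral_ninfty Pr Phi b X -> (\forall w \ae Pr, z w = sigma *: X w) ->
  borel_measurable z -> (\int[Pr]_w `|z w|%:E < +oo)%E.
Proof.
move=> [[mX iX] _] aez mz.
have mnz := @measurable_borel_norm _ _ _ (wienerSpace H) z mz.
have mnX := @measurable_borel_norm _ _ _ (wienerSpace H) X mX.
have mX2 : measurable_fun setT ((fun w => (`|X w| ^+ 2)%:E) : wienerSpace H -> \bar R).
  by apply/measurable_EFinP; exact: measurable_funX.
have m1X2 : measurable_fun setT
    ((fun w => 1%:E + (`|X w| ^+ 2)%:E) : wienerSpace H -> \bar R)%E.
  by apply: emeasurable_funD => //.
apply: (@le_lt_trans _ _ (\int[Pr]_w (`|sigma|%:E * (1%:E + (`|X w| ^+ 2)%:E)))%E).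
  apply: ae_ge0_le_integral => //.
  - exact/measurable_EFinP.
  - by move=> w _; rewrite mule_ge0// adde_ge0// lee_fin.
  - exact: measurable_funeM.
  apply: (@filterS _ _ (ae_filter_ringOfSetsType Pr)) aez => w -> _.
  rewrite normrZ -EFinD -EFinM lee_fin ler_wpM2l//.
  have := sqr_ge0 (`|X w| - 1); have := normr_ge0 (X w); nra.
rewrite ge0_integralZl_EFin//; last by move=> w _; rewrite adde_ge0// lee_fin.
rewrite lte_mul_pinfty// ?lee_fin// ge0_integralD//.
apply: lte_add_pinfty => //; rewrite integral_cst// mul1e.
apply: le_lt_trans (probability_le1 Pr _) _; first exact: measurableT.
exact: ltry.
Qed.

(** * Choice of the step length, temperedness of the difference, and conclusion *)

Theorem theorem6 (R : realType) (H : completeNormedModType R)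
    (ip : {dot H for @idfun R})
    (hH : hilbert ip) (hsep : separable H)
    (C : {linear H -> H}) (Pr : probability (wienerSpace H) R)
    (hC : trace_class_covariance ip C) (hPr : wiener_measure ip C Pr)
    (D : set H) (A : H -> H) (S : R -> {linear H -> H})
    (hS : strongly_continuous_group S) (hA : is_generator S D A)
    (sigma : R) (F : H -> H) (LF : R) (hF : LF.-lipschitz F)
    (P : {linear H -> H}) (alpha beta K eta : R)
    (hdich : exponential_dichotomy S P alpha beta K)
    (hgap : gap_condition alpha beta eta K LF)
    (ustar : path0 H -> H)
    (hu : unique_stationary_solution Pr S F sigma ustar)
    (zstar : path0 H -> H)
    (hz : exists2 X, is_wiener_integral_ninfty Pr (fun s => S (- s)) 0 X &
            \forall w \ae Pr, zstar w = sigma *: X w)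
    (hzsol : stationary_solution Pr S (fun=> 0) sigma zstar) :
  \forall w \ae Pr,
    manifold S P eta F ustar w =
    [set x + zstar w | x in manifold_tilde S P eta F zstar w].
Proof.
(* The absolute value provides a nonnegative Lipschitz constant, the sign of [LF] not being
   given. *)
pose L := `|LF|; have L0 : 0 <= L by exact: normr_ge0.
have FL x y : `|F x - F y| <= L * `|x - y|.
  apply: le_trans (hF (x, y) _) _; first by split.
  by rewrite ler_wpM2r// ler_norm.
have cF := lipschitz_continuous L0 FL.
have bS := dichotomy_group_bound hS hdich; have [M M1 SM] := bS.
have [eta0 be _ _] := hgap.
have [su _] := hu; have [mu _ _] := su; have [mz _ _] := hzsol.
have [X IX zX] := hz; have iz := wiener_ninfty_integrable IX zX mz.
have Pr_inv := wiener_measure_wshift hsep hPr.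
(* The step is short enough for the a priori bound: both [h <= 1] and [M * L * h <= 2^-1] hold. *)
pose h := (2 * (M * L + 1))^-1.
have M0 : 0 < M by exact: lt_le_trans M1.
have ML0 : 0 <= M * L by rewrite mulr_ge0// ltW.
have h2 : 0 < 2 * (M * L + 1) by rewrite mulr_gt0// ltr_wpDl.
have h0 : 0 < h by rewrite invr_gt0.
have h1 : h <= 1 by rewrite invf_le1//; lra.
have MLh : M * L * h <= 2^-1 by rewrite /h ler_pdivrMr//; lra.
pose B0 := 2 * M * (1 + `|F 0| + L).
have B0_ge0 : 0 <= B0.
  by rewrite /B0 !mulr_ge0 ?addr_ge0// ltW.
(* [B0 + 2] is the growth factor of [sz] over one step: [B0] comes from [d], and 2 from the norm of
   [zs], which is counted once in [sz] and once in bounding [us] by [d] and [zs]. *)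
have c1 : 1 <= B0 + 2 by move: B0_ge0; lra.
(* The slope per step is chosen so that growth over [n] steps is exactly
   [expR (- eta * (n%:R * h))], the rate allowed by the space with weight [eta]. *)
have eps0 : 0 < - eta * h by rewrite mulr_gt0// oppr_gt0.
have aegrowth := stationary_subexponential hsep Pr_inv mu mz iz h0 eps0 c1.
have aemild := stationary_difference_mild hsep hH hS bS cF su hzsol.
apply: (@filterS2 _ _ (ae_filter_ringOfSetsType Pr) _ _ _ _ aegrowth aemild).
move=> w growth [cu cz md].
pose us s := ustar (wshift s w); pose zs s := zstar (wshift s w).
pose d s := us s - zs s.
have cd : continuous d by move=> x; apply: cvgB; [exact: cu|exact: cz].
have gE : (fun r => F (us r)) = (fun r => F (d r + zs r)).
  by apply/funext => r; rewrite /d subrK.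
have md' : mild S d (fun r => F (d r + zs r)) by rewrite -gE.
have k_ge0 v : 0 <= zeta zstar h v by exact: zeta_ge0.
pose sz n := 1 + (`|us (- (n%:R * h))| + `|zs (- (n%:R * h))| +
  zeta zstar h (wshift (- (n%:R * h)) w)).
have zE n : \int[lebesgue_measure]_(r in `[- (n%:R * h) - h, - (n%:R * h)]) `|zs r| =
    zeta zstar h (wshift (- (n%:R * h)) w) by rewrite (zetaE h0 _ cz).
have nS n : - (n.+1%:R * h) = - (n%:R * h) - h by rewrite -natr1; ring.
have step n t : - (n.+1%:R * h) <= t -> t <= - (n%:R * h) -> `|d t| <= B0 * sz n.
  rewrite nS => ht tn.
  have := mild_step hH hS M1 SM L0 FL cd cz cF md' h0 h1 MLh ht tn.
  rewrite zE => /le_trans; apply.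
  have -> : B0 * sz n = 2 * M * ((1 + `|F 0| + L) * sz n) by rewrite /B0; ring.
  rewrite ler_wpM2l ?mulr_ge0 ?(ltW M0)//.
  have := ler_normB (us (- (n%:R * h))) (zs (- (n%:R * h))).
  have := k_ge0 (wshift (- (n%:R * h)) w).
  rewrite /sz -/(d _); set a := `|us _|; set b := `|zs _|; set k := zeta _ _ _.
  move=> k0 dab; have a0 : 0 <= a by exact: normr_ge0.
  have b0 : 0 <= b by exact: normr_ge0.
  have F0 := normr_ge0 (F 0).
  have : `|F 0| <= `|F 0| * (1 + (a + b + k)) by rewrite ler_peMr// lerDl !addr_ge0.
  have : L * k <= L * (1 + (a + b + k)) by rewrite ler_wpM2l//; lra.
  lra.
have [|B B_ge0 HB] := growth.
  move=> n /=; rewrite wshiftD [- h + _]addrC -nS.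
  have le_d := step n _ (lexx _); rewrite nS gerBl -nS in le_d.
  have {}le_d := le_d (ltW h0).
  have : `|us (- (n.+1%:R * h))| <= `|d (- (n.+1%:R * h))| + `|zs (- (n.+1%:R * h))|.
    by rewrite -{1}(subrK (zs (- (n.+1%:R * h))) (us _)) ler_normD.
  have := k_ge0 (wshift (- (n.+1%:R * h)) w).
  have sz1 : 1 <= sz n by rewrite lerDl !addr_ge0// zeta_ge0.
  rewrite -/(us (- (n%:R * h))) -/(zs (- (n%:R * h))) -/(sz n).
  rewrite -/(us (- (n.+1%:R * h))) -/(zs (- (n.+1%:R * h))).
  set a' := `|us _|; set b' := `|zs _|; set k' := zeta _ _ _ => k0 ad.
  have b0 : 0 <= b' by exact: normr_ge0.
  have s0 : 0 <= sz n by exact: le_trans sz1.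
  have B1 : B0 * sz n <= B0 * sz n * (1 + (b' + k')).
    have BS0 := mulr_ge0 B0_ge0 s0; rewrite ler_peMr//.
    by rewrite lerDl addr_ge0.
  have : 1 * (1 + (b' + k')) <= sz n * (1 + (b' + k')).
    by rewrite ler_wpM2r// !addr_ge0.
  move: B1 ad le_d; lra.
have szB n : sz n <= B * expR (- eta * (n%:R * h)).
  by apply: le_trans (HB n) _; rewrite [n%:R * (_ * _)]mulrCA.
have dB n t : - (n.+1%:R * h) <= t /\ t <= - (n%:R * h) ->
    `|d t| <= B0 * (B * expR (- eta * (n%:R * h))).
  by move=> [t1 t2]; apply: le_trans (step _ _ t1 t2) _; rewrite ler_wpM2l.
have zB n : \int[lebesgue_measure]_(r in `[- (n.+1%:R * h), - (n%:R * h)]) `|zs r| <=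
    B * expR (- eta * (n%:R * h)).
  rewrite nS zE; apply: le_trans (szB n); rewrite /sz addrA lerDr.
  by rewrite !addr_ge0.
apply: (manifold_eq hH hS hdich cF cu cz).
have cg : continuous (fun r => F (us r)).
  by move=> x; apply: (@continuous_comp _ _ _ us F); [exact: cu|exact: cF].
apply: (mild_lyapunov_perron hS hdich cd cg md be).
  by exists (B0 * B) => t; exact: (tempered_bound h0 eta0 dB B_ge0 B0_ge0).
have := tempered_integrable L0 FL cF cd cz h0 eta0 be dB zB B_ge0 B0_ge0.
by apply: eq_integrable => // r _; rewrite /= /d subrK.
Qed.
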